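(* Let $\mathcal{A}$ be an operator algebra. Consider the following statements. (i) There is a collection $\{\mathcal{B}_i\}_{i\in\Omega}$ of finite-dimensional operator algebras and a completely isometric homomorphism $\Phi:\mathcal{A}\to\prod_{i\in\Omega}\mathcal{B}_i$. (ii) There is a collection $\{\mathfrak{B}_i\}_{i\in\Omega}$ of finite-dimensional $C^*$-algebras and a completely isometric homomorphism $\Phi:\mathcal{A}\to\prod_{i\in\Omega}\mathfrak{B}_i$. (iii) For every $d\in\mathbb{N}$ and every $A\in\mathbb{M}_d(\mathcal{A})$, there is a finite-dimensional operator algebra $\mathcal{B}$ and a completely contractive homomorphism $\pi:\mathcal{A}\to\mathcal{B}$ such that $\|\pi^{(d)}(A)\|=\|A\|$. (iv) For every $d\in\mathbb{N}$ and every $A\in\mathbb{M}_d(\mathcal{A})$, there is a finite-dimensional $C^*$-algebra $\mathfrak{B}$ and a completely contractive homomorphism $\pi:\mathcal{A}\to\mathfrak{B}$ such that $\|\pi^{(d)}(A)\|=\|A\|$. Then (i) and (ii) are equivalent, and (iii) and (iv) are equivalent.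
   Context: An operator algebra is a norm closed subalgebra of $B(\mathfrak{H})$ for some complex Hilbert space $\mathfrak{H}$ (not necessarily containing the identity and not necessarily self-adjoint). $\mathbb{M}_d(\mathcal{A})$ is the space of $d\times d$ matrices over $\mathcal{A}\subset B(\mathfrak{H})$, with the norm inherited from $B(\mathfrak{H}^{(d)})$, where $\mathfrak{H}^{(d)}=\mathfrak{H}\oplus\cdots\oplus\mathfrak{H}$ ($d$ copies). For a linear map $\pi$ on $\mathcal{A}$, $\pi^{(d)}$ is its entrywise ampliation to $\mathbb{M}_d(\mathcal{A})$; $\pi$ is completely contractive (completely isometric) if $\pi^{(d)}$ is contractive (isometric) for every $d$. $\prod_{i}\mathcal{B}_i$ denotes the algebra of uniformly bounded families with the supremum norm, acting on the Hilbert space direct sum. *)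

(* Defs.v *)
From HB Require Import structures.
From mathcomp Require Import all_boot all_order all_algebra.
From mathcomp Require Import finmap sesquilinear complex.
From mathcomp Require Import boolp classical_sets functions cardinality fsbigop.
From mathcomp Require Import lra.
From mathcomp Require Import reals ereal topology normedtype esum.

Set Implicit Arguments.
Unset Strict Implicit.
Unset Printing Implicit Defensive.

Import Order.TTheory GRing.Theory Num.Theory.
Import numFieldNormedType.Exports.

Local Open Scope classical_set_scope.
Local Open Scope ring_scope.
Local Open Scope complex_scope.

(* The inner product is linear in its first argument. *)
HB.mixin Record isHilbert (R : realType) H & CompleteNormedModule R[i] H := {
  inner : {dot H for (@Num.conj R[i])} ;
  inner_norm : forall x : H, inner x x = `|x| ^+ 2
}.

#[short(type="hilbertType")]
HB.structure Definition Hilbert (R : realType) :=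
  {H of isHilbert R H & CompleteNormedModule R[i] H}.

Section DotNorm.
Context (C : numClosedFieldType) (U : lmodType C) (f : {dot U for (@Num.conj C)}).
Implicit Types u v : U.

Lemma dot_sym u v : f u v = (f v u)^*%R.
Proof. by rewrite hermC expr0 mul1r. Qed.

Lemma dot_cauchy_schwarz u v : `|f u v| ^+ 2 <= f u u * f v v.
Proof.
have [->|v0] := eqVneq v 0.
  by rewrite linear0r normr0 expr0n /= linear0l mulr0.
have vv0 : 0 < f v v by rewrite dnorm_gt0.
pose a := f u v / f v v; pose w := u - a *: v.
have wv : f w (a *: v) = 0.
  rewrite linearZr_LR /= /w linearBl linearZl_LR /= /a.
  by rewrite mulfVK ?subrr ?mulr0 // gt_eqF.
have -> : f u u = f w w + f (a *: v) (a *: v).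
  by rewrite -(hnormDd wv) /w subrK.
rewrite mulrDl -[leLHS]add0r lerD ?mulr_ge0 ?dnorm_ge0//.
rewrite dnormZ /a normrM exprMn (ger0_norm (x := _^-1)) ?invr_ge0 ?dnorm_ge0//.
by rewrite mulrAC -mulrA -mulrA -expr2 -exprMn mulVf ?expr1n ?mulr1 ?gt_eqF.
Qed.

Lemma dot_cauchy_schwarz_sqrt u v : `|f u v| <= sqrtC (f u u) * sqrtC (f v v).
Proof.
rewrite -(@ler_pXn2r _ 2) ?nnegrE ?mulr_ge0 ?sqrt_dnorm_ge0//.
by rewrite exprMn !sqrtCK dot_cauchy_schwarz.
Qed.

Lemma dot_triangle u v :
  sqrtC (f (u + v) (u + v)) <= sqrtC (f u u) + sqrtC (f v v).
Proof.
rewrite -(@ler_pXn2r _ 2) ?nnegrE ?addr_ge0 ?sqrt_dnorm_ge0//.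
rewrite sqrrD !sqrtCK dnormD addrAC lerD2r lerD2l.
apply: (@le_trans _ _ `|f u v + (f u v)^*%R|).
  by apply: real_ler_norm; rewrite CrealE rmorphD /= conjCK addrC.
apply: (le_trans (ler_normD _ _)).
by rewrite norm_conjC -mulr2n lerMn2r dot_cauchy_schwarz_sqrt orbT.
Qed.

Lemma dot_normZ (a : C) u : sqrtC (f (a *: u) (a *: u)) = `|a| * sqrtC (f u u).
Proof.
rewrite dnormZ sqrtCM ?qualifE/= ?exprn_ge0 ?dnorm_ge0//.
by rewrite sqrCK.
Qed.

End DotNorm.

Section RealNorm.
Context (R : realType) (V : normedModType R[i]).
Implicit Types x y : V.

(* The norm of a complex normed module takes its values in R[i]. *)
Definition rnorm x : R := complex.Re `|x|.

Lemma rnormE x : `|x| = (rnorm x)%:C.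
Proof. by rewrite /rnorm RRe_real // ger0_real. Qed.

Lemma rnorm_ge0 x : 0 <= rnorm x.
Proof. by rewrite -ler0c -rnormE. Qed.

Lemma rnorm0 : rnorm 0 = 0. Proof. by rewrite /rnorm normr0. Qed.

Lemma rnorm_eq0 x : (rnorm x == 0) = (x == 0).
Proof. by rewrite -[RHS]normr_eq0 rnormE (inj_eq (@complexI _)). Qed.

Lemma rnormD x y : rnorm (x + y) <= rnorm x + rnorm y.
Proof. by rewrite -lecR rmorphD /= -!rnormE ler_normD. Qed.

Lemma rnormZ (a : R[i]) x : rnorm (a *: x) = Normc.normc a * rnorm x.
Proof.
by apply: complexI; rewrite rmorphM /= -(rnormE x) -(rnormE (a *: x)) normrZ.
Qed.

Lemma rnorm_sum (I : Type) (r : seq I) (P : pred I) (F : I -> V) :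
  rnorm (\sum_(i <- r | P i) F i) <= \sum_(i <- r | P i) rnorm (F i).
Proof.
elim/big_rec2: _ => [|i y1 y2 _ h]; first by rewrite rnorm0.
exact: (le_trans (rnormD _ _)) (lerD _ _).
Qed.

End RealNorm.

Section BoundedOperators.
Context (R : realType) (H : hilbertType R).

Definition bounded_operator (f : H -> H) : Prop :=
  linear f /\ exists M : R, forall x, rnorm (f x) <= M * rnorm x.

Definition bounded_op : {pred H -> H} := fun f => `[< bounded_operator f >].

Record bop := Bop { bop_fun :> H -> H; bopP : bop_fun \in bounded_op }.

HB.instance Definition _ := [isSub for bop_fun].
HB.instance Definition _ := [Choice of bop by <:].

Lemma bop_linear (T : bop) : linear T.
Proof. by have /asboolP[] := bopP T. Qed.

HB.instance Definition _ (T : bop) :=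
  GRing.isLinear.Build R[i] H H *:%R T (bop_linear T).

Lemma bop_bounded (T : bop) : exists M : R, forall x, rnorm (T x) <= M * rnorm x.
Proof. by have /asboolP[] := bopP T. Qed.

Lemma bop_ext (S T : bop) : S =1 T -> S = T.
Proof. by move=> ST; apply/val_inj/funext. Qed.

Lemma bounded_operator_submod : submod_closed bounded_op.
Proof.
split.
  apply/asboolP; split; first by move=> a x y; rewrite /= scaler0 addr0.
  by exists 0 => x; rewrite rnorm0 mul0r.
move=> a f g /asboolP[lf [Mf bf]] /asboolP[lg [Mg bg]]; apply/asboolP; split.
  move=> b x y; rewrite /= !fctE lf lg !scalerDr !scalerA [a * b]mulrC.
  by rewrite addrACA.
exists (Normc.normc a * Mf + Mg) => x; rewrite fctE.
rewrite (le_trans (rnormD _ _))// mulrDl lerD//.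
rewrite rnormZ -mulrA ler_wpM2l//.
by rewrite -ler0c; exact: normr_ge0 a.
Qed.

HB.instance Definition _ := GRing.isSubmodClosed.Build R[i] (H -> H)
  bounded_op bounded_operator_submod.
HB.instance Definition _ := [SubChoice_isSubLmodule of bop by <:].

Lemma bopDE (S T : bop) x : (S + T) x = S x + T x. Proof. by []. Qed.
Lemma bopZE (a : R[i]) (T : bop) x : (a *: T) x = a *: T x. Proof. by []. Qed.
Lemma bop0E x : (0 : bop) x = 0. Proof. by []. Qed.

Lemma bounded_operator_comp (S T : bop) : bounded_operator (S \o T).
Proof.
split; first by move=> a x y; rewrite /= !linearP.
have [M bM] := bop_bounded S; have [N bN] := bop_bounded T.
exists (`|M| * N) => x /=; rewrite (le_trans (bM _))//.
rewrite (@le_trans _ _ (`|M| * rnorm (T x)))//.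
  by rewrite ler_wpM2r ?rnorm_ge0 ?ler_norm.
by rewrite -mulrA ler_wpM2l.
Qed.

Definition bop_comp (S T : bop) : bop :=
  Bop (introT (asboolP _) (bounded_operator_comp S T)).

Definition opnorm (T : bop) : R :=
  sup [set rnorm (T x) | x in [set x | rnorm x <= 1]].

Lemma opnorm_has_sup (T : bop) :
  has_sup [set rnorm (T x) | x in [set x | rnorm x <= 1]].
Proof.
split; first by exists (rnorm (T 0)), 0 => //=; rewrite rnorm0.
have [M bM] := bop_bounded T; exists `|M| => _ [x /= x1 <-].
rewrite (le_trans (bM _))// (@le_trans _ _ (`|M| * rnorm x))//.
  by rewrite ler_wpM2r ?rnorm_ge0 ?ler_norm.
by rewrite -[leRHS]mulr1 ler_wpM2l.
Qed.

Lemma opnorm_ge0 (T : bop) : 0 <= opnorm T.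
Proof.
apply: (@le_trans _ _ (rnorm (T 0))); first exact: rnorm_ge0.
by apply: (sup_upper_bound (opnorm_has_sup T)); exists 0 => //=; rewrite rnorm0.
Qed.

Lemma le_opnorm (T : bop) x : rnorm (T x) <= opnorm T * rnorm x.
Proof.
have [->|x0] := eqVneq x 0; first by rewrite linear0 rnorm0 mulr0.
have nx : 0 < rnorm x by rewrite lt_def rnorm_eq0 x0 rnorm_ge0.
have normcV : Normc.normc ((rnorm x)^-1)%:C = (rnorm x)^-1.
  by rewrite /= expr0n /= addr0 sqrtr_sqr ger0_norm// invr_ge0 ltW.
rewrite -ler_pdivrMr// mulrC -normcV -rnormZ -linearZ.
apply: (sup_upper_bound (opnorm_has_sup T)).
by exists (((rnorm x)^-1)%:C *: x) => //=; rewrite rnormZ normcV mulVf// gt_eqF.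
Qed.

Lemma opnorm_le (T : bop) (M : R) :
  0 <= M -> (forall x, rnorm (T x) <= M * rnorm x) -> opnorm T <= M.
Proof.
move=> M0 bM; apply: ge_sup; first by case: (opnorm_has_sup T).
move=> _ [x /= x1 <-]; rewrite (le_trans (bM x))//.
by rewrite -[leRHS]mulr1 ler_wpM2l.
Qed.

Let bop_norm (T : bop) : R[i] := (opnorm T)%:C.

Let bop_normD (S T : bop) : bop_norm (S + T) <= bop_norm S + bop_norm T.
Proof.
rewrite /bop_norm -rmorphD lecR; apply: opnorm_le => [|x].
  by rewrite addr_ge0 ?opnorm_ge0.
by rewrite bopDE (le_trans (rnormD _ _))// mulrDl lerD// le_opnorm.
Qed.

Let opnormZ_le (a : R[i]) (T : bop) :
  opnorm (a *: T) <= Normc.normc a * opnorm T.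
Proof.
have a0 : 0 <= Normc.normc a by rewrite -ler0c; exact: normr_ge0 a.
apply: opnorm_le => [|x]; first by rewrite mulr_ge0 ?opnorm_ge0.
by rewrite bopZE rnormZ -mulrA ler_wpM2l// le_opnorm.
Qed.

Let bop_normZ (a : R[i]) (T : bop) : bop_norm (a *: T) = `|a| * bop_norm T.
Proof.
rewrite /bop_norm -[ `|a| ]/(Normc.normc a)%:C -rmorphM; congr (_%:C).
have [->|a0] := eqVneq a 0.
  apply/le_anti; rewrite opnormZ_le Normc.normc0 mul0r/=.
  by rewrite opnorm_ge0.
apply/le_anti; rewrite opnormZ_le /=.
have na : 0 < Normc.normc a by rewrite -ltcR -[ltRHS]/(`|a|) normr_gt0.
rewrite mulrC -ler_pdivlMr//.
have := opnormZ_le a^-1 (a *: T).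
by rewrite scalerA mulVf// scale1r Normc.normcV mulrC.
Qed.

Let bop_norm_eq0 (T : bop) : bop_norm T = 0 -> T = 0.
Proof.
rewrite /bop_norm -[0]/(0%:C) => /complexI T0; apply: bop_ext => x.
apply/eqP; rewrite bop0E -rnorm_eq0; apply/eqP/le_anti.
by rewrite rnorm_ge0 andbT (le_trans (le_opnorm T x))// T0 mul0r.
Qed.

HB.instance Definition _ :=
  Lmodule_isNormed.Build R[i] bop bop_normD bop_normZ bop_norm_eq0.

Lemma bop_normE (T : bop) : `|T| = (opnorm T)%:C. Proof. by []. Qed.

Definition is_adjoint (T S : bop) : Prop :=
  forall x y, inner (T x) y = inner x (S y).

End BoundedOperators.

Section RealFamilies.
Context (R : realType) (I : choiceType).
Implicit Types f g p q : I -> R.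

Definition rsummable f : bool := summable [set: I] (EFin \o f).

(* Sum of an absolutely summable real family. *)
Definition rsum f : R :=
  fine (\esum_(i in [set: I]) (Num.max (f i) 0)%:E) -
  fine (\esum_(i in [set: I]) (Num.max (- f i) 0)%:E).

Let S f := \esum_(i in [set: I]) (f i)%:E.

Let S_ge0 f : (forall i, 0 <= f i) -> (0 <= S f)%E.
Proof. by move=> f0; apply: esum_ge0 => i _; rewrite lee_fin. Qed.

Lemma rsummableP f :
  (forall i, 0 <= f i) -> rsummable f = (\esum_(i in [set: I]) (f i)%:E < +oo)%E.
Proof.
move=> f0; rewrite /rsummable /summable; congr (_ < _)%E.
by apply: eq_esum => i _ /=; rewrite ger0_norm.
Qed.

Let S_fin f : (forall i, 0 <= f i) -> rsummable f -> S f \is a fin_num.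
Proof. by move=> f0; rewrite rsummableP// => h; rewrite ge0_fin_numE ?S_ge0. Qed.

Lemma rsummable_le f g : (forall i, `|f i| <= g i) -> rsummable g -> rsummable f.
Proof.
move=> fg; apply: le_lt_trans; apply: le_esum => i _ /=.
by rewrite lee_fin (le_trans (fg i)) ?ler_norm.
Qed.

Lemma rsummableD f g : rsummable f -> rsummable g -> rsummable (f \+ g).
Proof. by move=> sf sg; rewrite /rsummable; exact: (summableD sf sg). Qed.

Lemma rsummableN f : rsummable (\- f) = rsummable f.
Proof. by rewrite /rsummable [RHS]summableN. Qed.

Lemma rsummable_norm f : rsummable (fun i => `|f i|) = rsummable f.
Proof.
rewrite /rsummable /summable; congr (_ < _)%E; apply: eq_esum => i _ /=.
by rewrite normr_id.
Qed.

Let S_D f g : (forall i, 0 <= f i) -> (forall i, 0 <= g i) ->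
  S (f \+ g) = (S f + S g)%E.
Proof. by move=> f0 g0; rewrite /S -esumD// => i _; rewrite lee_fin. Qed.

Let pos f i := Num.max (f i) 0.

Let pos_ge0 f i : 0 <= pos f i. Proof. by rewrite /pos le_max lexx orbT. Qed.

Let pos_summable f : rsummable f -> rsummable (pos f).
Proof.
rewrite -rsummable_norm; apply: rsummable_le => i.
by rewrite (ger0_norm (pos_ge0 f i)) /pos ge_max ler_norm normr_ge0.
Qed.

Let posE f i : f i = pos f i - pos (\- f) i.
Proof.
rewrite /pos /=; have [f0|f0] := leP 0 (f i).
  by rewrite max_r ?subr0// oppr_le0.
by rewrite max_l ?sub0r ?opprK// oppr_ge0 ltW.
Qed.

Let rsum_diff f p q : (forall i, 0 <= p i) -> (forall i, 0 <= q i) ->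
  rsummable p -> rsummable q -> (forall i, f i = p i - q i) ->
  rsum f = fine (S p) - fine (S q).
Proof.
move=> p0 q0 sp sq fpq.
have sf : rsummable f.
  have : rsummable (p \+ (\- q)) by apply: rsummableD => //; rewrite rsummableN.
  by congr is_true; congr rsummable; apply/funext => i; rewrite fpq.
have sNf : rsummable (\- f) by rewrite rsummableN.
rewrite /rsum -/(S (pos f)) -/(S (pos (\- f))).
have : (S (pos f) + S q = S (pos (\- f)%R) + S p)%E.
  rewrite -!S_D //; apply: eq_esum => i _; congr (_%:E) => /=.
  by have := fpq i; rewrite [f i]posE /=; lra.
have [a ->] : exists a, S (pos f) = a%:E.
  by exists (fine (S (pos f))); rewrite fineK// S_fin// pos_summable.
have [b ->] : exists b, S (pos (\- f)) = b%:E.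
  by exists (fine (S (pos (\- f)))); rewrite fineK// S_fin// pos_summable.
have [c ->] : exists c, S p = c%:E by exists (fine (S p)); rewrite fineK// S_fin.
have [d ->] : exists d, S q = d%:E by exists (fine (S q)); rewrite fineK// S_fin.
rewrite -!EFinD => -[] /= abcd; apply/eqP.
by rewrite subr_eq addrAC eq_sym subr_eq abcd addrC.
Qed.

Lemma rsum_ge0E f : (forall i, 0 <= f i) -> rsummable f ->
  rsum f = fine (\esum_(i in [set: I]) (f i)%:E).
Proof.
move=> f0 sf; rewrite (@rsum_diff f f (cst 0)) //.
- rewrite -/(S f) [X in _ - X](_ : _ = 0) ?subr0//.
  by rewrite /S esum1.
- by rewrite /rsummable /summable esum1// => i _ /=; rewrite normr0.
- by move=> i; rewrite subr0.
Qed.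

Lemma rsumD f g : rsummable f -> rsummable g -> rsum (f \+ g) = rsum f + rsum g.
Proof.
move=> sf sg; have sNf : rsummable (\- f) by rewrite rsummableN.
have sNg : rsummable (\- g) by rewrite rsummableN.
rewrite (@rsum_diff (f \+ g) (pos f \+ pos g) (pos (\- f) \+ pos (\- g))).
- rewrite !S_D// !fineD ?S_fin ?pos_summable//.
  by rewrite opprD addrACA.
- by move=> i; rewrite addr_ge0.
- by move=> i; rewrite addr_ge0.
- by apply: rsummableD; apply: pos_summable.
- by apply: rsummableD; apply: pos_summable.
- by move=> i /=; rewrite [in LHS](posE f) [in LHS](posE g) opprD addrACA.
Qed.

Lemma rsumN f : rsum (\- f) = - rsum f.
Proof.
rewrite /rsum opprB; congr (_ - fine _).
by apply: eq_esum => i _; rewrite opprK.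
Qed.

Lemma fin_rsum_le f (X : {fset I}) : (forall i, 0 <= f i) -> rsummable f ->
  \sum_(i <- X) f i <= rsum f.
Proof.
move=> f0 sf; rewrite rsum_ge0E// -lee_fin fineK ?S_fin//.
apply: esum_ge; exists [set` X]; first by split.
by rewrite fsbig_finite//= set_fsetK sumEFin.
Qed.

Lemma rsum_le_bound f (M : R) : (forall i, 0 <= f i) ->
  (forall X : {fset I}, \sum_(i <- X) f i <= M) -> rsummable f /\ rsum f <= M.
Proof.
move=> f0 fM; have SM : (S f <= M%:E)%E.
  apply: ub_ereal_sup => _ [X [finX _] <-].
  by rewrite fsbig_finite//= sumEFin lee_fin.
have sf : rsummable f by rewrite rsummableP// (le_lt_trans SM) ?ltry.
by split=> //; rewrite rsum_ge0E// -lee_fin fineK ?S_fin.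
Qed.

Lemma rsum_ge0 f : (forall i, 0 <= f i) -> rsummable f -> 0 <= rsum f.
Proof. by move=> f0 sf; rewrite rsum_ge0E// fine_ge0 ?S_ge0. Qed.

Lemma ler_rsum f i : (forall i, 0 <= f i) -> rsummable f -> f i <= rsum f.
Proof. by move=> f0 sf; have := fin_rsum_le [fset i]%fset f0 sf; rewrite big_seq_fset1. Qed.

Lemma rsummableZ (a : R) f : rsummable f -> rsummable (fun i => a * f i).
Proof.
move=> sf; have [M fM] : exists M, forall X : {fset I}, \sum_(i <- X) `|f i| <= M.
  exists (rsum (fun i => `|f i|)) => X; apply: fin_rsum_le => //.
  by rewrite rsummable_norm.
rewrite -rsummable_norm.
apply: (rsum_le_bound (M := `|a| * M) _ _).1 => // X.
under eq_bigr do rewrite normrM.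
by rewrite -mulr_sumr ler_wpM2l.
Qed.

Lemma rsumZ (a : R) f : rsummable f -> rsum (fun i => a * f i) = a * rsum f.
Proof.
have pZ b g : 0 < b -> (forall i, 0 <= g i) -> rsummable g ->
    rsum (fun i => b * g i) <= b * rsum g.
  move=> b0 g0 sg; apply: (rsum_le_bound _ _).2 => [i|X].
    by rewrite mulr_ge0// ltW.
  by rewrite -mulr_sumr ler_wpM2l ?fin_rsum_le// ltW.
have ppZ b g : 0 < b -> (forall i, 0 <= g i) -> rsummable g ->
    rsum (fun i => b * g i) = b * rsum g.
  move=> b0 g0 sg; apply/le_anti; rewrite pZ//=.
  rewrite mulrC -ler_pdivlMr// mulrC.
  rewrite (le_trans _ (pZ b^-1 (fun i => b * g i) _ _ _)) ?invr_gt0//.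
  - by under eq_fun do rewrite mulKf ?gt_eqF//.
  - by move=> i; rewrite mulr_ge0// ltW.
  - exact: rsummableZ.
have fZ b g : 0 < b -> rsummable g -> rsum (fun i => b * g i) = b * rsum g.
  move=> b0 sg; have sNg : rsummable (\- g) by rewrite rsummableN.
  have -> : (fun i => b * g i) =
      (fun i => b * pos g i) \+ (\- (fun i => b * pos (\- g) i)).
    by apply/funext => i /=; rewrite [in LHS](posE g) mulrBr.
  rewrite rsumD ?rsummableN ?rsummableZ ?pos_summable// rsumN.
  rewrite !ppZ ?pos_summable// -mulrBr; congr (_ * _).
  rewrite -rsumN -rsumD ?rsummableN ?pos_summable//.
  by congr rsum; apply/funext => i /=; rewrite [in RHS](posE g).
move=> sf; have [a0|a0|<-] := ltgtP 0 a; first exact: fZ.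
- have -> : (fun i => a * f i) = \- (fun i => (- a) * f i).
    by apply/funext => i /=; rewrite mulNr opprK.
  by rewrite rsumN fZ ?oppr_gt0// mulNr opprK.
- rewrite mul0r; under eq_fun do rewrite mul0r.
  rewrite rsum_ge0E//; first by rewrite esum1.
  by rewrite /rsummable /summable esum1// => i _ /=; rewrite normr0.
Qed.

End RealFamilies.

Section ComplexFamilies.
Context (R : realType) (I : choiceType).
Implicit Types f g : I -> R[i].

Definition csummable f : bool := rsummable (fun i => Normc.normc (f i)).

Definition csum f : R[i] :=
  rsum (fun i => complex.Re (f i)) +i* rsum (fun i => complex.Im (f i)).

Lemma csummable_Re f : csummable f -> rsummable (fun i => complex.Re (f i)).
Proof. by apply: rsummable_le => i; rewrite -lecR; exact: normc_ge_Re. Qed.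

Lemma csummable_Im f : csummable f -> rsummable (fun i => complex.Im (f i)).
Proof.
apply: rsummable_le => i; case: (f i) => a b /=.
by rewrite -sqrtr_sqr ler_sqrt ?lerDr ?addr_ge0 ?sqr_ge0.
Qed.

Lemma csumD f g : csummable f -> csummable g -> csum (f \+ g) = csum f + csum g.
Proof.
move=> sf sg; apply/eqP; rewrite eq_complex /=; apply/andP; split; apply/eqP.
  rewrite -rsumD ?csummable_Re//; congr rsum; apply/funext => i /=.
  by case: (f i) (g i) => ? ? [].
rewrite -rsumD ?csummable_Im//; congr rsum; apply/funext => i /=.
by case: (f i) (g i) => ? ? [].
Qed.

Lemma csumZ (a : R[i]) f : csummable f -> csum (fun i => a * f i) = a * csum f.
Proof.
move=> sf; case: a => a b; apply/eqP; rewrite eq_complex /=.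
have sR := csummable_Re sf; have sI := csummable_Im sf.
apply/andP; split; apply/eqP.
  rewrite -!rsumZ// -rsumN -rsumD ?rsummableN ?rsummableZ//.
  by congr rsum; apply/funext => i /=; case: (f i).
rewrite -!rsumZ// -rsumD ?rsummableZ//.
by congr rsum; apply/funext => i /=; case: (f i).
Qed.

Lemma csum_conj f : csum (fun i => (f i)^*) = (csum f)^*.
Proof.
rewrite /csum /=; congr (_ +i* _).
  by congr rsum; apply/funext => i; case: (f i).
by rewrite -rsumN; congr rsum; apply/funext => i /=; case: (f i).
Qed.

Lemma csum_real (r : I -> R) : csum (fun i => (r i)%:C) = (rsum r)%:C.
Proof.
rewrite /csum /=; congr (_ +i* _).
rewrite rsum_ge0E//; first by rewrite esum1.
by rewrite /rsummable /summable esum1// => i _ /=; rewrite normr0.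
Qed.

End ComplexFamilies.

Section HilbertSum.
Context (R : realType) (I : choiceType) (H : I -> hilbertType R).

(* The Hilbert space direct sum of the family H: square-summable families. *)
Record hsum := HSum {
  hsum_val :> forall i, H i ;
  hsumP : rsummable (fun i => rnorm (hsum_val i) ^+ 2) }.

HB.instance Definition _ := gen_eqMixin hsum.
HB.instance Definition _ := gen_choiceMixin hsum.

Implicit Types x y z : hsum.

Lemma hsum_ext x y : (forall i, x i = y i) -> x = y.
Proof.
case: x y => [x xP] [y yP] /= xy.
have {}xy : x = y by apply: functional_extensionality_dep.
by case: _ / xy yP => yP; congr HSum; exact: Prop_irrelevance.
Qed.

Let sqr_sumD (x y : forall i, H i) i :
  rnorm (x i + y i) ^+ 2 <= 2 * (rnorm (x i) ^+ 2 + rnorm (y i) ^+ 2).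
Proof.
have h : rnorm (x i + y i) ^+ 2 <= (rnorm (x i) + rnorm (y i)) ^+ 2.
  by rewrite ler_pXn2r ?nnegrE ?addr_ge0 ?rnorm_ge0 ?rnormD.
have := sqr_ge0 (rnorm (x i) - rnorm (y i)).
by move: h; rewrite sqrrD sqrrB; lra.
Qed.

Lemma hsum_addP x y : rsummable (fun i => rnorm (x i + y i) ^+ 2).
Proof.
apply: (rsummable_le _ (rsummableZ 2 (rsummableD (hsumP x) (hsumP y)))) => i.
by rewrite ger0_norm ?sqr_ge0 ?sqr_sumD.
Qed.

Lemma hsum_scaleP (a : R[i]) x : rsummable (fun i => rnorm (a *: x i) ^+ 2).
Proof.
apply: (rsummable_le _ (rsummableZ (Normc.normc a ^+ 2) (hsumP x))) => i.
by rewrite ger0_norm ?sqr_ge0 // rnormZ exprMn.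
Qed.

Lemma hsum_zeroP : rsummable (fun i => rnorm (0 : H i) ^+ 2).
Proof.
apply: (rsum_le_bound (M := 0) _ _).1 => [i|X]; first exact: sqr_ge0.
by rewrite big1// => i _; rewrite rnorm0 expr0n.
Qed.

Definition hsum_zero := HSum hsum_zeroP.
Definition hsum_add x y := HSum (hsum_addP x y).
Definition hsum_scale a x := HSum (hsum_scaleP a x).
Definition hsum_opp x := hsum_scale (-1) x.

Let addA : associative hsum_add.
Proof. by move=> x y z; apply: hsum_ext => i /=; rewrite addrA. Qed.
Let addC : commutative hsum_add.
Proof. by move=> x y; apply: hsum_ext => i /=; rewrite addrC. Qed.
Let add0 : left_id hsum_zero hsum_add.
Proof. by move=> x; apply: hsum_ext => i /=; rewrite add0r. Qed.
Let addN : left_inverse hsum_zero hsum_opp hsum_add.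
Proof. by move=> x; apply: hsum_ext => i /=; rewrite scaleN1r addNr. Qed.

HB.instance Definition _ := GRing.isZmodule.Build hsum addA addC add0 addN.

Let scaleA a b x : hsum_scale a (hsum_scale b x) = hsum_scale (a * b) x.
Proof. by apply: hsum_ext => i /=; rewrite scalerA. Qed.
Let scale1 : left_id 1 hsum_scale.
Proof. by move=> x; apply: hsum_ext => i /=; rewrite scale1r. Qed.
Let scaleDr : right_distributive hsum_scale +%R.
Proof. by move=> a x y; apply: hsum_ext => i /=; rewrite scalerDr. Qed.
Let scaleDl x : {morph hsum_scale^~ x : a b / a + b}.
Proof. by move=> a b; apply: hsum_ext => i /=; rewrite scalerDl. Qed.

HB.instance Definition _ :=
  GRing.Zmodule_isLmodule.Build R[i] hsum scaleA scale1 scaleDr scaleDl.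

Lemma hsum0E i : (0 : hsum) i = 0. Proof. by []. Qed.
Lemma hsumDE x y i : (x + y) i = x i + y i. Proof. by []. Qed.
Lemma hsumZE (a : R[i]) x i : (a *: x) i = a *: x i. Proof. by []. Qed.
Lemma hsumNE x i : (- x) i = - x i. Proof. exact: scaleN1r. Qed.

Definition hsum_inner x y : R[i] := csum (fun i => inner (x i) (y i)).

Lemma normc_inner (K : hilbertType R) (u v : K) :
  Normc.normc (inner u v) <= rnorm u * rnorm v.
Proof.
have := dot_cauchy_schwarz_sqrt inner u v.
rewrite !inner_norm !sqrCK// (rnormE u) (rnormE v) -rmorphM.
by rewrite -[ `|inner u v| ]/(Normc.normc (inner u v))%:C lecR.
Qed.

Lemma hsum_inner_summable x y : csummable (fun i => inner (x i) (y i)).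
Proof.
apply: (rsummable_le _ (rsummableD (hsumP x) (hsumP y))) => i /=.
rewrite ger0_norm; last by rewrite -ler0c; exact: normr_ge0 (inner _ _).
have := normc_inner (x i) (y i).
have := sqr_ge0 (rnorm (x i) - rnorm (y i)).
by have := sqr_ge0 (rnorm (x i) + rnorm (y i)); rewrite sqrrB sqrrD; lra.
Qed.

Let hsum_inner_linear : bilinear_for
  (GRing.Scale.Law.clone _ _ ( *%R ) _)
  (GRing.Scale.Law.clone _ _ (@Num.conj R[i] \; *%R ) _) hsum_inner.
Proof.
have hl y : linear_for *%R (hsum_inner^~ y).
  move=> a u v /=; rewrite /hsum_inner -csumZ ?hsum_inner_summable//.
  rewrite -csumD; last exact: hsum_inner_summable.
  - by congr csum; apply/funext => i /=; rewrite linearDl linearZl_LR.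
  - have := hsum_inner_summable (a *: u) y; congr is_true; congr csummable.
    by apply/funext => i /=; rewrite linearZl_LR.
split=> // x a u v /=.
have hC w : hsum_inner x w = (hsum_inner w x)^*.
  by rewrite -csum_conj; congr csum; apply/funext => i; exact: dot_sym.
by rewrite !hC hl rmorphD rmorphM.
Qed.

HB.instance Definition _ := bilinear_isBilinear.Build R[i] hsum hsum R[i]
  (GRing.Scale.Law.clone _ _ ( *%R ) _)
  (GRing.Scale.Law.clone _ _ (@Num.conj R[i] \; *%R ) _) hsum_inner
  hsum_inner_linear.

Let hsum_inner_hermitian x y :
  hsum_inner x y = (-1) ^+ false * @Num.conj R[i] (hsum_inner y x).
Proof.
rewrite expr0 mul1r -[RHS]csum_conj.
by congr csum; apply/funext => i; exact: dot_sym.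
Qed.

HB.instance Definition _ := @isHermitianSesquilinear.Build R[i] hsum false
  (@Num.conj R[i]) hsum_inner hsum_inner_hermitian.

Lemma hsum_innerE x : hsum_inner x x = (rsum (fun i => rnorm (x i) ^+ 2))%:C.
Proof.
rewrite -csum_real; congr csum; apply/funext => i.
by rewrite inner_norm rnormE -rmorphXn.
Qed.

Let hsum_inner_gt0 x : x != 0 -> 0 < hsum_inner x x.
Proof.
move=> x0; rewrite hsum_innerE ltcR lt_def rsum_ge0 ?hsumP ?andbT//; last by move=> i; exact: sqr_ge0.
apply: contra x0 => /eqP s0; apply/eqP/hsum_ext => i.
apply/eqP; rewrite -rnorm_eq0 -sqrf_eq0; apply/eqP/le_anti.
rewrite sqr_ge0 andbT -s0.
by apply: (ler_rsum i _ (hsumP x)) => j; exact: sqr_ge0.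
Qed.

HB.instance Definition _ :=
  isDotProduct.Build R[i] hsum hsum_inner hsum_inner_gt0.

Let hsum_dot : {dot hsum for (@Num.conj R[i])} := hsum_inner.

Let hsum_norm x : R[i] := sqrtC (hsum_inner x x).

Let hsum_normD x y : hsum_norm (x + y) <= hsum_norm x + hsum_norm y.
Proof. exact: (dot_triangle hsum_dot). Qed.

Let hsum_normZ (a : R[i]) x : hsum_norm (a *: x) = `|a| * hsum_norm x.
Proof. exact: (dot_normZ hsum_dot). Qed.

Let hsum_norm_eq0 x : hsum_norm x = 0 -> x = 0.
Proof. by move/eqP; rewrite (sqrt_dnorm_eq0 hsum_dot) => /eqP. Qed.

HB.instance Definition _ :=
  Lmodule_isNormed.Build R[i] hsum hsum_normD hsum_normZ hsum_norm_eq0.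

Let hsum_inner_norm x : hsum_dot x x = `|x| ^+ 2.
Proof. by rewrite -[ `|x| ]/(hsum_norm x) sqrtCK. Qed.

Lemma rnorm_hsum x : rnorm x ^+ 2 = rsum (fun i => rnorm (x i) ^+ 2).
Proof.
apply: complexI; rewrite -hsum_innerE rmorphXn /= -rnormE.
by rewrite -hsum_inner_norm.
Qed.

Lemma rnorm_coord x i : rnorm (x i) <= rnorm x.
Proof.
rewrite -(@ler_pXn2r _ 2) ?nnegrE ?rnorm_ge0// rnorm_hsum.
by apply: (ler_rsum i _ (hsumP x)) => j; exact: sqr_ge0.
Qed.

Let ballE (V : normedModType R[i]) (u v : V) (e : R) :
  ball u e%:C v = (rnorm (u - v) < e) :> Prop.
Proof. by rewrite -ball_normE /ball_ /= rnormE ltcR. Qed.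

Let hsum_complete (F : set_system hsum) : ProperFilter F -> cauchy F -> cvg F.
Proof.
move=> FF /cauchyP Fc.
have {}Fc (e : R) : 0 < e -> exists x, \forall y \near F, rnorm (x - y) < e.
  rewrite -ltcR => /Fc[x xF]; exists x; apply: filterS xF => y.
  by rewrite ballE.
have cF i : cvg ((fun x : hsum => x i) @ F).
  apply: cauchy_cvg; apply: cauchy_exP => e e0.
  have eE : e = (complex.Re e)%:C by rewrite RRe_real// gtr0_real.
  have [|x xF] := Fc (complex.Re e); first by rewrite -ltcR -eE.
  exists (x i); suff : F [set y : hsum | ball (x i) e (y i)] by [].
  apply: filterS xF => y xy /=; rewrite eE ballE; apply: le_lt_trans xy.
  by have := rnorm_coord (x - y) i; rewrite hsumDE hsumNE.
pose l i : H i := lim ((fun x : hsum => x i) @ F).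
have key (e : R) x : 0 < e -> (\forall y \near F, rnorm (x - y) < e) ->
    forall X : {fset I}, \sum_(i <- X) rnorm (x i - l i) ^+ 2 <= (2 * e) ^+ 2.
  move=> e0 xF X; pose n := size X; pose d := e / n.+1%:R.
  have d0 : 0 < d by rewrite divr_gt0.
  have Xl : F [set y : hsum | forall i, i \in X -> rnorm (l i - y i) < d].
    have /(filter_bigI (D := X) (f := fun i => [set y : hsum | rnorm (l i - y i) < d])) : 
        forall i, i \in X -> F [set y : hsum | rnorm (l i - y i) < d].
      move=> i _; have /cvgrPdist_lt/(_ d%:C) := cF i.
      rewrite ltcR => /(_ d0); apply: filterS => y /=.
      by rewrite rnormE ltcR.
    by apply: filterS => y yX i iX; exact: yX.
  near F => y.
  have xy : rnorm (x - y) < e by near: y.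
  have ly : forall i, i \in X -> rnorm (l i - y i) < d by near: y.
  have -> : (2 * e) ^+ 2 = 2 * (e ^+ 2 + e ^+ 2) by rewrite exprMn; lra.
  apply: (@le_trans _ _ (\sum_(i <- X) 2 * (rnorm ((x - y) i) ^+ 2 + d ^+ 2))).
    rewrite big_seq [leRHS]big_seq; apply: ler_sum => i iX.
    have -> : x i - l i = (x - y) i + (y i - l i).
      by rewrite hsumDE hsumNE addrA subrK.
    apply: (le_trans (sqr_sumD (x - y) (fun i => y i - l i) i)).
    rewrite ler_wpM2l// lerD2l ler_pXn2r ?nnegrE ?rnorm_ge0 ?(ltW d0)//.
    by rewrite /rnorm distrC -/(rnorm _) ltW ?ly.
  rewrite -mulr_sumr ler_wpM2l// big_split lerD//=.
    apply: (@le_trans _ _ (rnorm (x - y) ^+ 2)).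
      by rewrite rnorm_hsum; apply: fin_rsum_le (hsumP (x - y)) => i; exact: sqr_ge0.
    by rewrite ler_pXn2r ?nnegrE ?rnorm_ge0 ?(ltW e0) ?(ltW xy).
  rewrite big_const_seq count_predT iter_addr_0 -/n /d expr_div_n.
  rewrite -(mulr_natr (e ^+ 2 / _)) mulrAC ler_pdivrMr ?exprn_gt0//.
  rewrite ler_wpM2l ?sqr_ge0// -natrX ler_nat.
  by rewrite (leq_trans (leqnSn n))// expnS leq_pmulr.
have key2 (e : R) x : 0 < e -> (\forall y \near F, rnorm (x - y) < e) ->
    exists2 z : hsum, (forall i, z i = x i - l i) & rnorm z <= 2 * e.
  move=> e0 xF.
  have [|sz le] := rsum_le_bound (f := fun i => rnorm (x i - l i) ^+ 2) _ (key _ _ e0 xF).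
    by move=> i; exact: sqr_ge0.
  exists (HSum sz) => //.
  by rewrite -(@ler_pXn2r _ 2) ?nnegrE ?rnorm_ge0 ?mulr_ge0 ?(ltW e0)// rnorm_hsum.
have [x1 x1F] := Fc 1 ltr01.
have [z1 z1E _] := key2 _ _ ltr01 x1F.
apply/cvg_ex; exists (x1 - z1); apply/cvgrPdist_lt => e e0.
have eE : e = (complex.Re e)%:C by rewrite RRe_real// gtr0_real.
have e40 : 0 < complex.Re e / 4 by rewrite divr_gt0// -ltcR -eE.
have [x xF] := Fc _ e40; have [z zE zle] := key2 _ _ e40 xF.
near=> y.
have xy : rnorm (x - y) < complex.Re e / 4 by near: y.
rewrite eE rnormE ltcR.
have -> : x1 - z1 - y = (x - y) - z.
  apply: hsum_ext => i; rewrite !hsumDE !hsumNE zE z1E.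
  by rewrite subKr [RHS]addrAC subKr.
have nz : rnorm (- z) = rnorm z by rewrite /rnorm normrN.
by have := rnormD (x - y) (- z); rewrite nz; lra.
Unshelve. all: by end_near. Qed.

HB.instance Definition _ := Uniform_isComplete.Build hsum hsum_complete.

HB.instance Definition _ := isHilbert.Build R hsum hsum_inner_norm.

Lemma hsum_inner_def x y : inner x y = csum (fun i => inner (x i) (y i)).
Proof. by []. Qed.

End HilbertSum.

Section Amplification.
Context (R : realType) (H : hilbertType R) (d : nat).

Lemma rsum_ord_le (f : 'I_d -> R) (B : R) : (forall i, 0 <= f i) ->
  (forall i, f i <= B) -> rsummable f /\ rsum f <= d%:R * B.
Proof.
move=> f0 fB; apply: rsum_le_bound => // X.
rewrite (le_trans (ler_sum _ (fun i _ => fB i)))//.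
rewrite big_const_seq count_predT iter_addr_0 -(mulr_natl B).
have sX : (size X <= d)%N.
  by rewrite -(card_uniqP (fset_uniq X)) -[leqRHS]card_ord max_card.
have [d0|d0] := posnP d.
  have /eqP -> : size X == 0%N by rewrite -leqn0 (leq_trans sX)// d0.
  by rewrite (_ : d%:R = 0) ?mul0r ?mulr0n // d0.
by rewrite ler_wpM2r ?ler_nat// (le_trans (f0 (Ordinal d0))).
Qed.

Lemma ord_summable (f : 'I_d -> R) : (forall i, 0 <= f i) -> rsummable f.
Proof.
move=> f0; apply: (rsum_ord_le (B := \sum_i f i) f0 _).1 => i.
by rewrite (bigD1 i)//= lerDl sumr_ge0.
Qed.

(* H^(d), the direct sum of d copies of H. *)
Definition hpow := hsum (fun _ : 'I_d => H).

Implicit Type M : 'M[bop H]_d.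

Definition mxop_fun M (x : hpow) : hpow :=
  HSum (hsum_val := fun i => \sum_j M i j (x j))
    (ord_summable (fun i => sqr_ge0 (rnorm (\sum_j M i j (x j))))).

Lemma mxop_bounded M : mxop_fun M \in @bounded_op R hpow.
Proof.
apply/asboolP; split.
  move=> a x y; apply: hsum_ext => i /=; rewrite scaler_sumr -big_split /=.
  by apply: eq_bigr => j _; rewrite linearP.
pose K := \sum_i \sum_j opnorm (M i j).
have K0 : 0 <= K by apply: sumr_ge0 => i _; apply: sumr_ge0 => j _; exact: opnorm_ge0.
exists (d.+1%:R * K) => x.
rewrite -(@ler_pXn2r _ 2) ?nnegrE ?mulr_ge0 ?rnorm_ge0// rnorm_hsum.
rewrite (le_trans (rsum_ord_le (B := (K * rnorm x) ^+ 2) _ _).2)//.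
- by move=> i; exact: sqr_ge0.
- move=> i; rewrite ler_pXn2r ?nnegrE ?mulr_ge0 ?rnorm_ge0//.
  apply: (le_trans (rnorm_sum _ _ _)).
  apply: (@le_trans _ _ (\sum_j opnorm (M i j) * rnorm x)).
    apply: ler_sum => j _; apply: (le_trans (le_opnorm _ _)).
    by rewrite ler_wpM2l ?opnorm_ge0 ?rnorm_coord.
  rewrite -mulr_suml ler_wpM2r ?rnorm_ge0// /K [leRHS](bigD1 i)//= lerDl.
  by apply: sumr_ge0 => k _; apply: sumr_ge0 => j _; exact: opnorm_ge0.
- rewrite -mulrA [leRHS]exprMn ler_wpM2r ?sqr_ge0// -natrX ler_nat.
  by rewrite (leq_trans (leqnSn d))// expnS leq_pmulr.
Qed.

Definition mxop M : bop hpow := Bop (mxop_bounded M).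

Definition mxnorm M : R[i] := `|mxop M|.

End Amplification.

Section OperatorAlgebras.
Context (R : realType).

Record operator_algebra (H : hilbertType R) (A : set (bop H)) : Prop := {
  opalg0 : A 0 ;
  opalgD : forall S T, A S -> A T -> A (S + T) ;
  opalgZ : forall (a : R[i]) T, A T -> A (a *: T) ;
  opalgM : forall S T, A S -> A T -> A (bop_comp S T) ;
  opalg_closed : closed A }.

(* C*-algebras are taken concretely, as self-adjoint operator algebras, so that
   their matrix norms are those inherited from bop H. *)
Record cstar_algebra (H : hilbertType R) (A : set (bop H)) : Prop := {
  cstar_opalg : operator_algebra A ;
  cstar_adjoint : forall T, A T -> exists2 S, A S & is_adjoint T S }.

Definition finite_dimensional (H : hilbertType R) (A : set (bop H)) : Prop :=
  exists (n : nat) (e : 'I_n -> bop H), (forall k, A (e k)) /\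
    forall T, A T -> exists c : 'I_n -> R[i], T = \sum_k c k *: e k.

(* The algebra of uniformly bounded families (b i) with b i in B i, acting
   diagonally on the Hilbert space direct sum. *)
Definition prod_algebra (I : choiceType) (K : I -> hilbertType R)
    (B : forall i, set (bop (K i))) : set (bop (hsum K)) :=
  [set T : bop (hsum K) | exists b : forall i, bop (K i),
    [/\ forall i, B i (b i),
        exists M : R, forall i, opnorm (b i) <= M &
        forall (x : hsum K) i, T x i = b i (x i)]].

(* A map on A is represented by a function on all of bop H, of which only the
   restriction to A is constrained. *)
Record algebra_hom (H K : hilbertType R) (A : set (bop H)) (B : set (bop K))
    (f : bop H -> bop K) : Prop := {
  hom_sub : forall T, A T -> B (f T) ;
  homD : forall S T, A S -> A T -> f (S + T) = f S + f T ;
  homZ : forall (a : R[i]) T, A T -> f (a *: T) = a *: f T ;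
  homM : forall S T, A S -> A T -> f (bop_comp S T) = bop_comp (f S) (f T) }.

Definition mx_over (H : hilbertType R) (A : set (bop H)) (d : nat) :
    set 'M[bop H]_d := [set M | forall i j, A (M i j)].

Definition completely_contractive (H K : hilbertType R) (A : set (bop H))
    (f : bop H -> bop K) : Prop :=
  forall (d : nat) (M : 'M[bop H]_d), (0 < d)%N -> mx_over A M ->
    mxnorm (map_mx f M) <= mxnorm M.

Definition completely_isometric (H K : hilbertType R) (A : set (bop H))
    (f : bop H -> bop K) : Prop :=
  forall (d : nat) (M : 'M[bop H]_d), (0 < d)%N -> mx_over A M ->
    mxnorm (map_mx f M) = mxnorm M.

End OperatorAlgebras.

(* Main.v *)
(* Let B be a finite-dimensional operator algebra on K. For x in K^(d) the
   coordinates of x together with their images under a basis of B span a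
   B-invariant subspace, whose dimension is bounded independently of x. By
   Gram-Schmidt the compressions of B to these subspaces are completely
   contractive homomorphisms into one matrix algebra M_N(C). For M in M_d(B),
   taking near-maximizing vectors x for the norm of M and passing to the limit
   along an ultrafilter gives a completely contractive homomorphism of B into
   M_N(C) attaining the norm of M, hence (iii) => (iv). The direct sum of all
   the homomorphisms obtained from the factors B_i is completely isometric on
   the product of the B_i, hence (i) => (ii). *)
Require Import Defs.
From mathcomp Require Import all_boot all_order all_algebra complex.
From mathcomp Require Import boolp classical_sets reals topology normedtype.
From mathcomp Require Import finmap sesquilinear sequences lra ring.

Set Implicit Arguments.
Unset Strict Implicit.
Unset Printing Implicit Defensive.

Import Order.TTheory GRing.Theory Num.Theory.
Import numFieldNormedType.Exports.

Local Open Scope classical_set_scope.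
Local Open Scope ring_scope.

(** * Finite sums and rules for the inner product *)

Lemma rsum_fin (R : realType) (I : finType) (f : I -> R) :
  (forall i, 0 <= f i) -> rsum f = \sum_i f i.
Proof.
move=> f0.
have [sf le] : rsummable f /\ rsum f <= \sum_i f i.
  apply: rsum_le_bound => // X; rewrite (big_uniq (X : seq I)) ?fset_uniq//=.
  by rewrite [X in _ <= X](bigID (fun i => i \in (X : seq I)))/= lerDl sumr_ge0.
apply/le_anti; rewrite le/=.
have := fin_rsum_le [fset i | i in I]%fset f0 sf; apply: le_trans.
rewrite [X in _ <= X](big_uniq [fset i | i in I]%fset) ?fset_uniq//=.
by rewrite [X in _ <= X](eq_bigl xpredT)// => i; rewrite !inE.
Qed.

Section Inner.
Context (R : realType) (H : hilbertType R).
Implicit Types (x y z : H) (a : R[i]).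

Lemma innerDl x y z : inner (x + y) z = inner x z + inner y z.
Proof. exact: linearDl. Qed.

Lemma innerZl a x y : inner (a *: x) y = a * inner x y.
Proof. exact: linearZl_LR. Qed.

Lemma inner0l x : inner 0 x = 0 :> R[i].
Proof. exact: linear0l. Qed.

Lemma inner_suml (I : Type) (r : seq I) (P : pred I) (F : I -> H) y :
  inner (\sum_(i <- r | P i) F i) y = \sum_(i <- r | P i) inner (F i) y.
Proof. by apply: linear_sumlz. Qed.

Lemma inner_conj x y : inner x y = Num.conj (inner y x).
Proof. exact: dot_sym. Qed.

Lemma innerZr a x y : inner x (a *: y) = Num.conj a * inner x y.
Proof. by rewrite inner_conj innerZl rmorphM [in RHS]inner_conj. Qed.

Lemma inner_sumr (I : Type) (r : seq I) (P : pred I) (F : I -> H) x :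
  inner x (\sum_(i <- r | P i) F i) = \sum_(i <- r | P i) inner x (F i).
Proof.
rewrite inner_conj inner_suml rmorph_sum; apply: eq_bigr => i _.
by rewrite [RHS]inner_conj.
Qed.

Lemma inner_rnorm x : inner x x = (rnorm x ^+ 2)%:C%C.
Proof. by rewrite inner_norm rnormE rmorphXn. Qed.

End Inner.

Lemma normc_sqr (R : realType) (a : R[i]) :
  a * Num.conj a = (Normc.normc a ^+ 2)%:C%C.
Proof. by rewrite -normCK -[ `|a| ]/((Normc.normc a)%:C)%C rmorphXn. Qed.

Lemma normc_real (R : realType) (r : R) : 0 <= r -> Normc.normc (r%:C)%C = r.
Proof. by move=> r0; rewrite /= expr0n /= addr0 sqrtr_sqr ger0_norm. Qed.

(** * Orthogonal frames, their projections and Gram-Schmidt *)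

Section Frames.
Context (R : realType) (H : hilbertType R).

(* Vectors are allowed to vanish, so that the length of a frame can be fixed in
   advance. *)
Definition orthoframe (n : nat) (f : 'I_n -> H) :=
  (forall i j, i != j -> inner (f i) (f j) = 0 :> R[i]) /\
  (forall i, inner (f i) (f i) *: f i = f i).

(** For an orthoframe this is the orthogonal projection onto the span, since every [f i] is a unit
    vector or zero. *)
Definition fproj n (f : 'I_n -> H) (x : H) : H := \sum_i inner x (f i) *: f i.

Lemma fproj_linear n (f : 'I_n -> H) (a : R[i]) x y :
  fproj f (a *: x + y) = a *: fproj f x + fproj f y.
Proof.
rewrite /fproj scaler_sumr -big_split; apply: eq_bigr => i _.
by rewrite innerDl innerZl scalerDl scalerA.
Qed.

Section FrameTheory.
Context (n : nat) (f : 'I_n -> H) (fo : orthoframe f).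

Lemma orthoframe_inner (y : 'I_n -> R[i]) j :
  inner (\sum_i y i *: f i) (f j) = y j * inner (f j) (f j).
Proof.
rewrite inner_suml (bigD1 j)//= innerZl big1 ?addr0// => i ij.
by rewrite innerZl fo.1// mulr0.
Qed.

(** The factor [inner (f j) (f j)] is 1 unless [f j] is zero, and then both sides vanish; pairing
    [x] with the frame identity treats both cases at once. *)
Lemma inner_frame_id x j : inner x (f j) * inner (f j) (f j) = inner x (f j).
Proof.
have := congr1 (inner x) (fo.2 j); rewrite innerZr => e.
by rewrite -[RHS]e mulrC -inner_conj.
Qed.

Lemma frame_rnorm_le1 j : rnorm (f j) ^+ 2 <= 1.
Proof.
have := congr1 (@rnorm R H) (fo.2 j); rewrite rnormZ inner_rnorm.
rewrite normc_real ?sqr_ge0//.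
have [->|j0] := eqVneq (rnorm (f j)) 0; first by rewrite expr0n.
by rewrite -[RHS]mul1r => /(mulIf j0) ->.
Qed.

Lemma rnorm_frame_comb (y : 'I_n -> R[i]) :
  rnorm (\sum_i y i *: f i) ^+ 2 = \sum_i Normc.normc (y i) ^+ 2 * rnorm (f i) ^+ 2.
Proof.
apply: complexI; rewrite -inner_rnorm inner_sumr rmorph_sum; apply: eq_bigr => j _.
by rewrite innerZr orthoframe_inner mulrA [_ * y j]mulrC normc_sqr inner_rnorm -rmorphM.
Qed.

Lemma rnorm_frame_le (y : 'I_n -> R[i]) :
  rnorm (\sum_i y i *: f i) ^+ 2 <= \sum_i Normc.normc (y i) ^+ 2.
Proof.
rewrite rnorm_frame_comb; apply: ler_sum => i _.
by rewrite ler_piMr ?sqr_ge0 ?frame_rnorm_le1.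
Qed.

Lemma rnorm_fproj x :
  rnorm (fproj f x) ^+ 2 = \sum_i Normc.normc (inner x (f i)) ^+ 2.
Proof.
rewrite /fproj rnorm_frame_comb; apply: eq_bigr => i _.
have := congr1 (@Normc.normc R) (inner_frame_id x i).
rewrite Normc.normcM inner_rnorm normc_real ?sqr_ge0//.
have [->|x0] := eqVneq (Normc.normc (inner x (f i))) 0; first by rewrite expr0n !mul0r.
by rewrite -[RHS]mulr1 => /(mulfI x0) ->; rewrite mulr1.
Qed.

Lemma fproj_orth x : inner (x - fproj f x) (fproj f x) = 0 :> R[i].
Proof.
rewrite {2}/fproj inner_sumr big1// => j _; rewrite innerZr -scaleN1r innerDl innerZl.
by rewrite orthoframe_inner inner_frame_id mulN1r subrr mulr0.
Qed.

(** Pythagoras for the splitting of [x] into [fproj f x] and an orthogonal remainder. *)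
Lemma bessel x : \sum_i Normc.normc (inner x (f i)) ^+ 2 <= rnorm x ^+ 2.
Proof.
rewrite -rnorm_fproj.
have : inner x x = inner (x - fproj f x) (x - fproj f x) +
    inner (fproj f x) (fproj f x) :> R[i].
  by rewrite -(hnormDd (fproj_orth x)) subrK.
by rewrite !inner_rnorm -rmorphD => /complexI ->; rewrite lerDr sqr_ge0.
Qed.

End FrameTheory.

(** The last clause places the frame in the span of [s], phrased through predicates closed under
    linear combinations; in this form invariance under an algebra passes from [s] to the frame. The
    length stays [size s] because dependent vectors contribute zeros. *)
Lemma gram_schmidt (s : seq H) : exists f : 'I_(size s) -> H,
  [/\ orthoframe f, forall v, v \in s -> fproj f v = v &
   forall E : H -> Prop, E 0 -> (forall a x y, E x -> E y -> E (a *: x + y)) ->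
     (forall v, v \in s -> E v) -> forall i, E (f i)].
Proof.
elim: s => [|v s [f [fo fs fE]]].
  exists (fun i : 'I_0 => False_rect H (notF (ltn_ord i))).
  by split=> [|//|E _ _ _ []//]; split=> [[]//|[]//].
(* If [v] already lies in the span of [f], then [w] and [g] vanish and a zero vector joins the
   frame. *)
pose w := v - fproj f v; pose g := (rnorm w)^-1%:C%C *: w.
have wf j : inner w (f j) = 0 :> R[i].
  rewrite /w -scaleN1r innerDl innerZl /fproj orthoframe_inner//.
  by rewrite inner_frame_id// mulN1r subrr.
have gf j : inner g (f j) = 0 :> R[i] by rewrite innerZl wf mulr0.
have fg j : inner (f j) g = 0 :> R[i] by rewrite inner_conj gf rmorph0.
have gg : inner g g *: g = g.
  rewrite /g innerZl innerZr inner_rnorm scalerA.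
  have [->|w0] := eqVneq (rnorm w) 0; first by rewrite invr0 mulr0 scale0r.
  congr (_ *: _).
  rewrite -[Num.conj _]/((_)^*)%C conjc_real -!rmorphM; congr (_%:C)%C.
  by field.
exists (fun i : 'I_(size s).+1 => if unlift ord0 i is Some j then f j else g).
have fpE x :
    fproj (fun i : 'I_(size s).+1 => if unlift ord0 i is Some j then f j else g) x =
    inner x g *: g + fproj f x.
  rewrite /fproj big_ord_recl/= unlift_none; congr (_ + _).
  by apply: eq_bigr => i _; rewrite liftK.
split.
- split=> [i j|i].
    case: unliftP => [i' ->|->]; case: unliftP => [j' ->|->] => // ij.
    by rewrite fo.1//; apply: contra_neq ij => ->.
  by case: unliftP => [i' _|_] //; exact: fo.2.
- move=> x; rewrite inE fpE => /orP[/eqP ->|xs]; last first.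
    (* An older vector is a combination of the [f i], all orthogonal to [g], so its new coordinate
       is zero. *)
    rewrite -{1}(fs _ xs) /fproj inner_suml big1 ?scale0r ?add0r ?fs//.
      by rewrite -/(fproj f _) fs.
    by move=> i _; rewrite innerZl fg mulr0.
  have -> : inner v g *: g = w; last by rewrite subrK.
  have -> : inner v g = inner w g.
    rewrite -[v in LHS](subrK (fproj f v)) innerDl -/w inner_suml big1 ?addr0//.
    by move=> i _; rewrite innerZl fg mulr0.
  rewrite /g innerZr inner_rnorm scalerA.
  have [w0|w0] := eqVneq (rnorm w) 0.
    have /eqP -> : w == 0 by rewrite -rnorm_eq0 w0.
    by rewrite scaler0.
  rewrite -[Num.conj _]/((_)^*)%C conjc_real -!rmorphM.
  rewrite mulrAC -expr2 exprVn mulVf ?expf_neq0//.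
  exact: scale1r.
- move=> E E0 El Es.
  have Ef : forall j, E (f j).
    by move=> j; apply: fE => // x xs; apply: Es; rewrite inE xs orbT.
  have Ep (y : 'I_(size s) -> R[i]) : E (\sum_i y i *: f i).
    elim/big_ind: _ => // [x x' Ex Ex'|i _]; last by rewrite -[_ *: _]addr0; apply: El.
    by rewrite -[x]scale1r; apply: El.
  have Ew : E w.
    by rewrite /w addrC -scaleN1r; apply: El; [exact: Ep|exact: (Es _ (mem_head _ _))].
  move=> i; case: unliftP => [j _//|_].
  by rewrite /g -[_ *: _]addr0; apply: El.
Qed.

End Frames.

(** * Operator norms in squared form, and norms of matrices of operators *)

Section OperatorNorm.
Context (R : realType) (H : hilbertType R).

Lemma le_opnorm_sqr (T : bop H) x :
  rnorm (T x) ^+ 2 <= opnorm T ^+ 2 * rnorm x ^+ 2.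
Proof.
rewrite -exprMn ler_pXn2r ?nnegrE ?mulr_ge0 ?opnorm_ge0 ?rnorm_ge0//.
exact: le_opnorm.
Qed.

Lemma opnorm_le_sqr (T : bop H) (C : R) : 0 <= C ->
  (forall x, rnorm (T x) ^+ 2 <= C ^+ 2 * rnorm x ^+ 2) -> opnorm T <= C.
Proof.
move=> C0 TC; apply: opnorm_le => // x.
by rewrite -(@ler_pXn2r _ 2) ?nnegrE ?mulr_ge0 ?rnorm_ge0// exprMn.
Qed.

Lemma opnorm_approx (T : bop H) (e : R) : 0 < e ->
  exists2 x, rnorm x <= 1 & opnorm T - e < rnorm (T x).
Proof.
move=> e0; have [_ [x x1 <-] lt] := sup_adherent e0 (opnorm_has_sup T).
by exists x.
Qed.

Lemma bop_sumE (I : Type) (r : seq I) (P : pred I) (S : I -> bop H) x :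
  (\sum_(i <- r | P i) S i) x = \sum_(i <- r | P i) S i x.
Proof. by elim/big_rec2: _ => // i y T _ <-. Qed.

End OperatorNorm.

Section MatrixNorm.
Context (R : realType) (H : hilbertType R) (d : nat).
Implicit Type M : 'M[bop H]_d.

Lemma rnorm_hpow (z : hpow H d) : rnorm z ^+ 2 = \sum_q rnorm (z q) ^+ 2.
Proof. by rewrite rnorm_hsum rsum_fin// => q; exact: sqr_ge0. Qed.

Lemma mxopE M (z : hpow H d) p : mxop M z p = \sum_q M p q (z q).
Proof. by []. Qed.

Lemma mxnormE M : mxnorm M = (opnorm (mxop M))%:C%C.
Proof. by []. Qed.

Definition hvec (x : 'I_d -> H) : hpow H d :=
  HSum (hsum_val := x) (ord_summable (fun i => sqr_ge0 (rnorm (x i)))).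

End MatrixNorm.

(** Since $H^{(1)}$ is a copy of $H$, the case $d = 1$ of complete contractivity yields plain
    contractivity. *)
Lemma opnorm_mx11 (R : realType) (H : hilbertType R) (T : bop H) :
  opnorm (mxop (const_mx T : 'M[bop H]_1)) = opnorm T.
Proof.
apply/le_anti/andP; split; apply: opnorm_le_sqr; rewrite ?opnorm_ge0// => x.
  by rewrite !rnorm_hpow !big_ord1 mxopE big_ord1 mxE le_opnorm_sqr.
have := le_opnorm_sqr (mxop (const_mx T : 'M[bop H]_1)) (hvec (fun=> x)).
by rewrite !rnorm_hpow !big_ord1 mxopE big_ord1 mxE.
Qed.

(** * A concrete matrix algebra spanned by rank-one operators *)

Lemma rank_one_bounded (R : realType) (H : hilbertType R) (u v : H) :
  (fun w => inner w v *: u : H) \in @bounded_op R H.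
Proof.
apply/asboolP; split=> [a x y|].
  by rewrite innerDl innerZl scalerDl scalerA.
exists (rnorm v * rnorm u) => w; rewrite rnormZ mulrAC ler_wpM2r ?rnorm_ge0//.
by rewrite mulrC normc_inner.
Qed.

Definition rank_one (R : realType) (H : hilbertType R) (u v : H) : bop H :=
  Bop (rank_one_bounded u v).

Section MatrixUnits.
Context (R : realType) (L : hilbertType R) (N : nat) (u : 'I_N -> L).
Implicit Types (m : 'M[R[i]]_N) (T : bop L).

(** For orthonormal [u] this embeds $M_N(\mathbb{C})$ in [bop L]; [mxact 1%:M] is the projection
    onto the span of [u], in general not the identity. *)
Definition mxact m : bop L := \sum_i \sum_j m i j *: rank_one (u i) (u j).

Lemma mxactE m w : mxact m w = \sum_i (\sum_j m i j * inner w (u j)) *: u i.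
Proof.
rewrite bop_sumE; apply: eq_bigr => i _; rewrite bop_sumE scaler_suml.
by apply: eq_bigr => j _; rewrite bopZE scalerA.
Qed.

Definition compression T : 'M[R[i]]_N := \matrix_(i, j) inner (T (u j)) (u i).

Lemma compression_linear a S T :
  compression (a *: S + T) = a *: compression S + compression T.
Proof. by apply/matrixP => i j; rewrite !mxE bopDE bopZE innerDl innerZl. Qed.

Lemma mxactD m1 m2 : mxact (m1 + m2) = mxact m1 + mxact m2.
Proof.
rewrite -big_split; apply: eq_bigr => i _; rewrite -big_split; apply: eq_bigr => j _.
by rewrite mxE scalerDl.
Qed.

Lemma mxactZ a m : mxact (a *: m) = a *: mxact m.
Proof.
rewrite scaler_sumr; apply: eq_bigr => i _; rewrite scaler_sumr.
by apply: eq_bigr => j _; rewrite mxE scalerA.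
Qed.

Hypothesis uo : forall i j, inner (u i) (u j) = (i == j)%:R :> R[i].

Lemma orthonormal_orthoframe : orthoframe u.
Proof.
by split=> [i j /negPf ij|i]; rewrite uo ?ij// eqxx scale1r.
Qed.

Lemma inner_mxact m w k : inner (mxact m w) (u k) = \sum_j m k j * inner w (u j).
Proof.
by rewrite mxactE orthoframe_inner ?uo ?eqxx ?mulr1//; exact: orthonormal_orthoframe.
Qed.

Lemma mxactM m1 m2 : mxact (m1 *m m2) = bop_comp (mxact m1) (mxact m2).
Proof.
apply: bop_ext => w; rewrite [RHS]/= !mxactE; apply: eq_bigr => i _; congr (_ *: _).
rewrite -mxactE; under [RHS]eq_bigr do rewrite inner_mxact mulr_sumr.
rewrite exchange_big/=; apply: eq_bigr => j _; rewrite mxE mulr_suml.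
by apply: eq_bigr => k _; rewrite mulrA.
Qed.

Lemma mxact_adjoint m : is_adjoint (mxact m) (mxact (map_mx Num.conj m^T)).
Proof.
move=> x y; rewrite !mxactE inner_suml inner_sumr.
under eq_bigr do rewrite innerZl mulr_suml.
under [RHS]eq_bigr do rewrite innerZr rmorph_sum mulr_suml.
rewrite exchange_big/=; apply: eq_bigr => i _; apply: eq_bigr => j _.
by rewrite !mxE rmorphM/= conjCK -inner_conj mulrAC.
Qed.

Definition matrix_units_algebra : set (bop L) := range mxact.

Lemma mxact1E w : mxact 1%:M w = fproj u w.
Proof.
rewrite mxactE; apply: eq_bigr => i _; congr (_ *: _).
rewrite (bigD1 i)//= big1 => [|j ji]; first by rewrite mxE eqxx mul1r addr0.
by rewrite mxE eq_sym (negPf ji) mul0r.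
Qed.

Lemma compressionE T :
  mxact (compression T) = bop_comp (mxact 1%:M) (bop_comp T (mxact 1%:M)).
Proof.
apply: bop_ext => w; rewrite [RHS]/= !mxact1E mxactE; apply: eq_bigr => i _.
congr (_ *: _); rewrite linear_sum inner_suml; apply: eq_bigr => j _.
by rewrite linearZ innerZl mxE mulrC.
Qed.

Lemma compressionK m : compression (mxact m) = m.
Proof.
apply/matrixP => i j; rewrite mxE inner_mxact (bigD1 j)//= big1 => [|k kj].
  by rewrite uo eqxx mulr1 addr0.
by rewrite uo eq_sym (negPf kj) mulr0.
Qed.

Lemma mxact1_contractive w : rnorm (mxact 1%:M w) <= rnorm w.
Proof.
rewrite -(@ler_pXn2r _ 2) ?nnegrE ?rnorm_ge0// mxact1E.
by rewrite rnorm_fproj ?bessel//; exact: orthonormal_orthoframe.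
Qed.

Lemma opnorm_compression T : opnorm (mxact (compression T)) <= opnorm T.
Proof.
apply: opnorm_le => [|w]; first exact: opnorm_ge0.
rewrite compressionE (le_trans (mxact1_contractive _))// (le_trans (le_opnorm T _))//.
by rewrite ler_wpM2l ?opnorm_ge0 ?mxact1_contractive.
Qed.

(** With $P$ the projection onto the span of [u], the map $G(S) = PSP - S$ vanishes on the algebra
    and satisfies $\|G(S)\| \le 2\|S\|$. If $G(T) \neq 0$, an element $T'$ of the algebra with $\|T
    - T'\| < \|G(T)\|/4$ gives $\|G(T)\| = \|G(T - T')\| < \|G(T)\|/2$, a contradiction. *)
Lemma matrix_units_closed : closed matrix_units_algebra.
Proof.
move=> T clT; exists (compression T) => //; apply/eqP; rewrite -subr_eq0.
pose G (S : bop L) := mxact (compression S) - S.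
rewrite -/(G T) -[_ == 0]/(G T == 0); rewrite -rnorm_eq0; apply/negPn/negP => GT.
have e0 : 0 < rnorm (G T) / 4 by rewrite divr_gt0// lt_def GT rnorm_ge0.
have /clT[T' [[m _ mT'] TT']] : nbhs T (ball T ((rnorm (G T) / 4)%:C)%C).
  by apply: nbhsx_ballx; rewrite ltcR.
move: TT'; rewrite -ball_normE /ball_ /= rnormE ltcR => TT'.
have GT' : G T = G (T - T').
  have cTT' : compression (T - T') = compression T - m.
    rewrite -mT' -[- mxact m]scaleN1r addrC compression_linear compressionK//.
    by rewrite scaleN1r addrC.
  by rewrite /G cTT' -[- m]scaleN1r mxactD mxactZ scaleN1r mT' opprB addrA subrK.
have : rnorm (G T) <= 2 * rnorm (T - T').
  rewrite GT' /G (le_trans (rnormD _ _))// mulrDl mul1r lerD//.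
    exact: opnorm_compression.
  by rewrite /rnorm normrN.
have : 0 < rnorm (G T) by rewrite lt_def GT rnorm_ge0.
by lra.
Qed.

Lemma matrix_units_cstar : cstar_algebra matrix_units_algebra.
Proof.
split; [split|].
- by exists 0 => //; rewrite -[0](scale0r 0) mxactZ scale0r.
- by move=> _ _ [m1 _ <-] [m2 _ <-]; exists (m1 + m2) => //; rewrite mxactD.
- by move=> a _ [m _ <-]; exists (a *: m) => //; rewrite mxactZ.
- by move=> _ _ [m1 _ <-] [m2 _ <-]; exists (m1 *m m2) => //; rewrite mxactM.
- exact: matrix_units_closed.
- move=> _ [m _ <-]; exists (mxact (map_mx Num.conj m^T)); first by eexists.
  exact: mxact_adjoint.
Qed.

Lemma matrix_units_findim : finite_dimensional matrix_units_algebra.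
Proof.
exists #|{: 'I_N * 'I_N}|, (fun k => rank_one (u (enum_val k).1) (u (enum_val k).2)).
split=> [k|_ [m _ <-]].
  exists (delta_mx (enum_val k).1 (enum_val k).2) => //.
  rewrite /mxact (bigD1 (enum_val k).1)//= [X in _ + X]big1 ?addr0 => [|i /negPf ki].
    rewrite (bigD1 (enum_val k).2)//= big1 ?addr0 => [|j /negPf kj].
      by rewrite mxE !eqxx scale1r.
    by rewrite mxE kj andbF scale0r.
  by rewrite big1// => j _; rewrite mxE ki scale0r.
exists (fun k => m (enum_val k).1 (enum_val k).2).
rewrite /mxact pair_big/= (reindex (fun k : 'I_#|{: 'I_N * 'I_N}| => enum_val k))//=.
by apply: onW_bij; exact: enum_val_bij.
Qed.

End MatrixUnits.

(** * Limits of bounded sequences along an ultrafilter *)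

Lemma ultrafilter_image (S T : Type) (h : S -> T) (U : set_system S) :
  UltraFilter U -> UltraFilter (h @ U).
Proof.
move=> UU; split; first exact: fmap_proper_filter.
move=> G GP hG; apply/seteqP; split => // A GA.
have [//|UnA] := in_ultra_setVsetC (h @^-1` A) UU.
have GnA : G (~` A) by exact: hG.
by case: (@filter_not_empty _ G GP); rewrite -(setICr A); exact: filterI.
Qed.

Lemma cvg_sumR (R : realType) (F : set_system nat) {FF : Filter F} (I : finType)
    (g : I -> nat -> R) (l : I -> R) :
  (forall i, g i n @[n --> F] --> l i) -> \sum_i g i n @[n --> F] --> \sum_i l i.
Proof.
move=> gl.
exact: (@cvg_big R I +%R 0 xpredT add_continuous nat F _ g l FF (fun i _ => gl i)).
Qed.

Section ComplexLimits.
Context (R : realType) (U : set_system nat) {UU : UltraFilter U}.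
Implicit Types (g h : nat -> R[i]) (z w : R[i]).

Definition clim g z : Prop :=
  complex.Re (g n) @[n --> U] --> complex.Re z /\
  complex.Im (g n) @[n --> U] --> complex.Im z.

Lemma clim_unique g z w : clim g z -> clim g w -> z = w.
Proof.
move=> [gz gz'] [gw gw']; apply/eqP; rewrite eq_complex; apply/andP.
split; apply/eqP; first exact: (cvg_unique (@Rhausdorff R) gz gw).
exact: (cvg_unique (@Rhausdorff R) gz' gw').
Qed.

(** Real and imaginary parts stay in a compact segment, where every ultrafilter converges. Without
    passing to subsequences, one [U] serves all bounded sequences at once. *)
Lemma bounded_clim g (B : R) : (forall n, Normc.normc (g n) <= B) ->
  exists z, clim g z.
Proof.
move=> gB.
have real_lim (h : nat -> R) : (forall n, `|h n| <= B) -> exists l : R, h @ U --> l.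
  move=> hB; have := segment_compact (a := - B) (b := B).
  rewrite compact_ultra => /(_ _ (ultrafilter_image h UU))[|l [_ hl]]; last by exists l.
  have -> : (h @ U) [set` `[- B, B]] = U setT; last exact: filterT.
  by congr U; apply/seteqP; split=> // n _ /=; rewrite in_itv/= -ler_norml.
have [a ga] : exists l : R, complex.Re (g n) @[n --> U] --> l.
  by apply: real_lim => n; rewrite (le_trans _ (gB n))// -lecR; exact: normc_ge_Re.
have [b gb] : exists l : R, complex.Im (g n) @[n --> U] --> l.
  apply: real_lim => n; rewrite (le_trans _ (gB n))//; case: (g n) => x y /=.
  by rewrite -sqrtr_sqr ler_sqrt ?lerDr ?addr_ge0 ?sqr_ge0.
by exists (a +i* b)%C.
Qed.

Lemma clim_cst z : clim (fun=> z) z.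
Proof. by split; exact: cvg_cst. Qed.

Lemma climM g h z w : clim g z -> clim h w -> clim (fun n => g n * h n) (z * w).
Proof.
move=> [g1 g2] [h1 h2]; case: z w g1 g2 h1 h2 => [a b] [c d] /= g1 g2 h1 h2; split.
  have -> : (fun n => complex.Re (g n * h n)) =
    (fun n => complex.Re (g n) * complex.Re (h n) - complex.Im (g n) * complex.Im (h n)).
    by apply/funext => n; case: (g n) => ? ?; case: (h n).
  exact: cvgB (cvgM g1 h1) (cvgM g2 h2).
have -> : (fun n => complex.Im (g n * h n)) =
  (fun n => complex.Re (g n) * complex.Im (h n) + complex.Im (g n) * complex.Re (h n)).
  by apply/funext => n; case: (g n) => ? ?; case: (h n).
by apply: cvgD; apply: cvgM.
Qed.

Lemma climD g h z w : clim g z -> clim h w -> clim (fun n => g n + h n) (z + w).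
Proof.
move=> [g1 g2] [h1 h2]; split; rewrite !raddfD /=.
  have -> : (fun n => complex.Re (g n + h n)) =
    (fun n => complex.Re (g n) + complex.Re (h n)).
    by apply/funext => n; rewrite raddfD.
  exact: cvgD.
have -> : (fun n => complex.Im (g n + h n)) =
  (fun n => complex.Im (g n) + complex.Im (h n)).
  by apply/funext => n; rewrite raddfD.
exact: cvgD.
Qed.

Lemma clim_sum (I : finType) (g : I -> nat -> R[i]) (z : I -> R[i]) :
  (forall i, clim (g i) (z i)) -> clim (fun n => \sum_i g i n) (\sum_i z i).
Proof.
move=> gz; elim: (index_enum I) => [|i r IH].
  rewrite big_nil; have -> : (fun n => \sum_(i <- [::]) g i n) = fun=> 0.
    by apply/funext => n; rewrite big_nil.
  exact: clim_cst.
rewrite big_cons; have -> : (fun n => \sum_(j <- i :: r) g j n) =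
    (fun n => g i n + \sum_(j <- r) g j n).
  by apply/funext => n; rewrite big_cons.
exact: climD.
Qed.

(** The squared modulus is a polynomial in the real and imaginary parts. *)
Lemma clim_normc_sqr g z : clim g z ->
  Normc.normc (g n) ^+ 2 @[n --> U] --> Normc.normc z ^+ 2.
Proof.
have E (w : R[i]) : Normc.normc w ^+ 2 =
    complex.Re w * complex.Re w + complex.Im w * complex.Im w.
  by case: w => a b /=; rewrite sqr_sqrtr ?addr_ge0 ?sqr_ge0// !expr2.
move=> [g1 g2]; rewrite E.
have -> : (fun n => Normc.normc (g n) ^+ 2) = (fun n =>
    complex.Re (g n) * complex.Re (g n) + complex.Im (g n) * complex.Im (g n)).
  by apply/funext => n; rewrite E.
by apply: cvgD; apply: cvgM.
Qed.

End ComplexLimits.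

(* The squared norm of the vector obtained by applying the d x d matrix m of
   N x N matrices to y in (C^N)^d. *)
Definition blocksqr (R : realType) (d N : nat) (m : 'I_d -> 'I_d -> 'M[R[i]]_N)
    (y : 'I_d -> 'I_N -> R[i]) : R :=
  \sum_p \sum_i Normc.normc (\sum_q \sum_j m p q i j * y q j) ^+ 2.

Lemma blocksqr_cvg (R : realType) (U : set_system nat) {UU : UltraFilter U} (d N : nat)
    (m_ : nat -> 'I_d -> 'I_d -> 'M[R[i]]_N) (y_ : nat -> 'I_d -> 'I_N -> R[i])
    (m : 'I_d -> 'I_d -> 'M[R[i]]_N) y :
  (forall p q i j, clim U (fun n => m_ n p q i j) (m p q i j)) ->
  (forall q j, clim U (fun n => y_ n q j) (y q j)) ->
  blocksqr (m_ n) (y_ n) @[n --> U] --> blocksqr m y.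
Proof.
move=> mm yy; apply: cvg_sumR => p; apply: cvg_sumR => i; apply: clim_normc_sqr.
by apply: clim_sum => q; apply: clim_sum => j; apply: climM.
Qed.

(** * Block matrices of scalars: compressions and their norms *)

Section BlockCompression.
Context (R : realType) (K : hilbertType R) (d N : nat) (f : 'I_N -> K).
Hypothesis fo : orthoframe f.
Implicit Type M : 'M[bop K]_d.

(** Let [w q] be the combination of the [f j] with coefficients [y q j]. Entry [i] of block [p] is
    the inner product of row [p] of $Mw$ with [f i], and [rnorm_fproj] sums the squares. *)
Lemma blocksqr_compressionE M (y : 'I_d -> 'I_N -> R[i]) :
  blocksqr (fun p q => compression f (M p q)) y =
  \sum_p rnorm (fproj f (mxop M (hvec (fun q => \sum_j y q j *: f j)) p)) ^+ 2.
Proof.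
apply: eq_bigr => p _; rewrite rnorm_fproj//; apply: eq_bigr => i _.
congr (Normc.normc _ ^+ 2); rewrite mxopE inner_suml; apply: eq_bigr => q _.
rewrite /= linear_sum inner_suml; apply: eq_bigr => j _.
by rewrite linearZ innerZl mxE mulrC.
Qed.

Lemma rnorm_fproj_le x : rnorm (fproj f x) ^+ 2 <= rnorm x ^+ 2.
Proof. by rewrite rnorm_fproj// bessel. Qed.

(** Forming combinations of the frame and projecting back onto it do not increase norms. *)
Lemma blocksqr_compression_le M y :
  blocksqr (fun p q => compression f (M p q)) y <=
  opnorm (mxop M) ^+ 2 * \sum_q \sum_j Normc.normc (y q j) ^+ 2.
Proof.
rewrite blocksqr_compressionE; set w := hvec _.
apply: (@le_trans _ _ (rnorm (mxop M w) ^+ 2)).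
  by rewrite rnorm_hpow; apply: ler_sum => p _; exact: rnorm_fproj_le.
rewrite (le_trans (le_opnorm_sqr _ _))// ler_wpM2l ?sqr_ge0//.
by rewrite rnorm_hpow; apply: ler_sum => q _; exact: rnorm_frame_le.
Qed.

End BlockCompression.

Section BlockAction.
Context (R : realType) (L : hilbertType R) (d N : nat) (u : 'I_N -> L).
Hypothesis uo : forall i j, inner (u i) (u j) = (i == j)%:R :> R[i].
Variable m : 'I_d -> 'I_d -> 'M[R[i]]_N.
Let T : 'M[bop L]_d := \matrix_(p, q) mxact u (m p q).

Lemma rnorm_orthonormal_comb (y : 'I_N -> R[i]) :
  rnorm (\sum_i y i *: u i) ^+ 2 = \sum_i Normc.normc (y i) ^+ 2.
Proof.
rewrite rnorm_frame_comb; last exact: orthonormal_orthoframe.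
apply: eq_bigr => i _; have := uo i i; rewrite eqxx inner_rnorm => /(@complexI _ _ 1) ->.
by rewrite mulr1.
Qed.

Lemma rnorm_mxop_mxact z :
  rnorm (mxop T z) ^+ 2 = blocksqr m (fun q j => inner (z q) (u j)).
Proof.
rewrite rnorm_hpow; apply: eq_bigr => p _; rewrite mxopE.
under eq_bigr do rewrite mxE mxactE.
rewrite exchange_big/=; under eq_bigr do rewrite -scaler_suml.
by rewrite rnorm_orthonormal_comb.
Qed.

(** Only the coordinates of [z] along [u] matter, and Bessel bounds them by the norm of [z]. *)
Lemma opnorm_mxop_mxact_le (C : R) : 0 <= C ->
  (forall y, blocksqr m y <= C ^+ 2 * \sum_q \sum_j Normc.normc (y q j) ^+ 2) ->
  opnorm (mxop T) <= C.
Proof.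
move=> C0 mC; apply: opnorm_le_sqr => // z; rewrite rnorm_mxop_mxact.
rewrite (le_trans (mC _))// ler_wpM2l ?sqr_ge0// rnorm_hpow.
by apply: ler_sum => q _; apply: bessel; exact: orthonormal_orthoframe.
Qed.

(** Evaluate the operator at the vector whose coordinates along [u] are [y]. *)
Lemma blocksqr_le_opnorm y :
  blocksqr m y <= opnorm (mxop T) ^+ 2 * \sum_q \sum_j Normc.normc (y q j) ^+ 2.
Proof.
have := le_opnorm_sqr (mxop T) (hvec (fun q => \sum_j y q j *: u j)).
rewrite rnorm_mxop_mxact rnorm_hpow.
under [X in _ <= _ * X]eq_bigr do rewrite rnorm_orthonormal_comb.
apply: le_trans; rewrite le_eqVlt; apply/orP; left; apply/eqP.
congr blocksqr; apply/funext => q; apply/funext => j.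
by rewrite orthoframe_inner ?uo ?eqxx ?mulr1//; exact: orthonormal_orthoframe.
Qed.

End BlockAction.

(** * Norm-attaining homomorphisms of a finite-dimensional algebra into a matrix algebra *)

(** The space [V] may have dimension below [N], so one unit vector of [V] is placed in each summand
    of $V^{(N)}$. *)
Lemma orthonormal_exists (R : realType) (V : hilbertType R) (v : V) (N : nat) :
  v != 0 -> exists (L : hilbertType R) (u : 'I_N -> L),
    forall i j, inner (u i) (u j) = (i == j)%:R :> R[i].
Proof.
move=> v0; pose w : V := ((rnorm v)^-1)%:C%C *: v.
have w1 : rnorm w = 1.
  rewrite /w rnormZ normc_real ?invr_ge0 ?rnorm_ge0//.
  by rewrite mulVf// rnorm_eq0.
pose u (i : 'I_N) : hpow V N := hvec (fun k => if k == i then w else 0).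
exists (hpow V N), u => i j; have [<-|ij] := eqVneq i j.
  rewrite inner_rnorm rnorm_hpow (bigD1 i)//= eqxx w1 big1 ?addr0 ?expr1n// => k.
  by move=> /negPf ->; rewrite rnorm0 expr0n.
rewrite hsum_inner_def -[LHS]/(csum (fun k => inner (u i k) (u j k))).
have -> : (fun k => inner (u i k) (u j k)) = (fun=> (0 : R)%:C%C).
  apply/funext => k /=; case: eqVneq => [->|_]; last by rewrite inner0l.
  by rewrite (negPf ij) inner_conj inner0l rmorph0.
by rewrite csum_real rsum_fin// big1.
Qed.

(** The length counts the [d] coordinates of [x] and their [n * d] images under a spanning family of
    [B]. The coordinates are listed separately because [B] may lack the identity. *)
Lemma invariant_frame (R : realType) (K : hilbertType R) (B : set (bop K)) (d : nat) :
  operator_algebra B -> finite_dimensional B ->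
  exists N, forall x : 'I_d -> K, exists F : 'I_N -> K,
    [/\ orthoframe F, forall q, fproj F (x q) = x q &
     forall T, B T -> (forall q, fproj F (T (x q)) = T (x q)) /\
       forall j, fproj F (T (F j)) = T (F j)].
Proof.
move=> Balg [n [e [eB eT]]]; exists (d + n * d)%N => x.
pose s := codom x ++ [seq e k (x q) | k <- enum 'I_n, q <- enum 'I_d].
have sN : size s = (d + n * d)%N.
  by rewrite size_cat size_codom size_allpairs !size_enum_ord card_ord.
have := gram_schmidt s; rewrite sN => -[F [Fo Fs FE]]; exists F.
have xs q : x q \in s by rewrite mem_cat codom_f.
have exs k q : e k (x q) \in s.
  by rewrite mem_cat; apply/orP; right; apply: allpairs_f; rewrite mem_enum.
have F0 : fproj F 0 = 0 by apply: big1 => i _; rewrite inner0l scale0r.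
have key T : B T -> forall q, fproj F (T (x q)) = T (x q).
  move=> /eT[c ->] q; rewrite bop_sumE.
  elim/big_ind: _ => // [v w Fv Fw|k _].
    by rewrite -[v]scale1r fproj_linear Fv Fw.
  by rewrite bopZE -[_ *: _]addr0 fproj_linear F0 Fs.
split=> // [q|T BT]; [exact: Fs|split=> [|j]; first exact: key].
(* Being mapped into the span by every element of [B] is a linear condition on [w], so checking it
   on [s] suffices. *)
apply: (FE (fun w => forall S, B S -> fproj F (S w) = S w)) (T) (BT).
- by move=> S _; rewrite linear0.
- by move=> a v w vS wS S BS; rewrite linearP fproj_linear vS ?wS.
- move=> v; rewrite mem_cat => /orP[/codomP[q ->] S BS|]; first exact: key.
  move=> /allpairsP[[k q] /= [_ _ ->]] S BS.
  by apply: (key (bop_comp S (e k))); exact: (opalgM Balg).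
Qed.

Lemma compression_normc (R : realType) (H : hilbertType R) n (f : 'I_n -> H)
    (T : bop H) i j : orthoframe f -> Normc.normc (compression f T i j) <= opnorm T.
Proof.
move=> fo; have f1 k : rnorm (f k) <= 1.
  by rewrite -(@ler_pXn2r _ 2) ?nnegrE ?rnorm_ge0// expr1n; exact: frame_rnorm_le1.
rewrite mxE (le_trans (normc_inner _ _))//.
rewrite (@le_trans _ _ (rnorm (T (f j)) * 1))//; first by rewrite ler_wpM2l ?rnorm_ge0.
rewrite mulr1 (le_trans (le_opnorm _ _))// -[leRHS]mulr1.
by rewrite ler_wpM2l ?opnorm_ge0.
Qed.

(** As [T] maps the span of [f] into itself, the projection can be inserted between [S] and [T]. *)
Lemma compressionM (R : realType) (H : hilbertType R) n (f : 'I_n -> H) (S T : bop H) :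
  (forall j, fproj f (T (f j)) = T (f j)) ->
  compression f (bop_comp S T) = compression f S *m compression f T.
Proof.
move=> fT; apply/matrixP => i j; rewrite !mxE [bop_comp S T _]/= -{1}fT linear_sum.
rewrite inner_suml; apply: eq_bigr => k _.
by rewrite linearZ innerZl !mxE mulrC.
Qed.

Lemma opnorm_approx_sqr (R : realType) (H : hilbertType R) (T : bop H) (e : R) :
  0 < e -> exists2 x, rnorm x <= 1 & opnorm T ^+ 2 - e <= rnorm (T x) ^+ 2.
Proof.
(* The defect [c] makes $2\|T\|c \le e$; the added 1 keeps the denominator positive. *)
move=> e0; have C0 := opnorm_ge0 T; pose c := e / (2 * opnorm T + 1).
have c0 : 0 < c by rewrite divr_gt0// ltr_wpDl ?mulr_ge0.
have [x x1 xT] := opnorm_approx T c0; exists x => //.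
have ce : 2 * opnorm T * c <= e.
  rewrite /c mulrA ler_pdivrMr ?ltr_wpDl ?mulr_ge0//.
  by rewrite mulrC ler_wpM2l ?(ltW e0)// lerDl.
(* Squaring the estimate requires $\|T\| - c \ge 0$; otherwise $\|T\|^2 \le \|T\|c \le e$ and the
   bound is trivial. *)
have r0 := rnorm_ge0 (T x); have [Cc|/ltW Cc] := leP (opnorm T) c.
  rewrite (le_trans _ (sqr_ge0 _))// subr_le0 (le_trans _ ce)// expr2.
  rewrite (@le_trans _ _ (opnorm T * c))//; first by rewrite ler_wpM2l.
  by rewrite -mulrA ler_peMl ?ler1n//; exact: (mulr_ge0 C0 (ltW c0)).
have : (opnorm T - c) ^+ 2 <= rnorm (T x) ^+ 2.
  by rewrite ler_pXn2r ?nnegrE ?subr_ge0// ltW.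
rewrite sqrrB; have := sqr_ge0 c; rewrite mulr_natl in ce; lra.
Qed.

Lemma opnorm_eq0_mxop (R : realType) (H K : hilbertType R) d (M : 'M[bop H]_d) :
  opnorm (mxop (map_mx (fun=> 0 : bop K) M)) = 0.
Proof.
apply/le_anti; rewrite opnorm_ge0 andbT; apply: opnorm_le => // z.
rewrite mul0r -[leRHS](rnorm0 (hpow K d)) (_ : mxop _ z = 0)//.
by apply: hsum_ext => p; rewrite mxopE big1// => q _; rewrite mxE bop0E.
Qed.

Lemma findim_cstar_attained (R : realType) (K : hilbertType R) (B : set (bop K))
    (d : nat) (M : 'M[bop K]_d) :
  (0 < d)%N -> operator_algebra B -> finite_dimensional B -> mx_over B M ->
  exists (L : hilbertType R) (C : set (bop L)) (rho : bop K -> bop L),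
    [/\ cstar_algebra C, finite_dimensional C, algebra_hom B C rho,
        completely_contractive B rho & mxnorm (map_mx rho M) = mxnorm M].
Proof.
move=> d0 Balg Bfin BM.
(* For a matrix of norm zero the zero map into the algebra of $0 \times 0$ matrices works. *)
have [M0|M0] := eqVneq (opnorm (mxop M)) 0.
  pose u (i : 'I_0) : K := 0.
  have uo i j : inner (u i) (u j) = (i == j)%:R :> R[i] by case: i.
  exists K, (matrix_units_algebra u), (fun=> 0); split.
  - exact: matrix_units_cstar.
  - exact: matrix_units_findim.
  - split=> [T _|S T _ _|a T _|S T _ _].
    + exact: (opalg0 (cstar_opalg (matrix_units_cstar uo))).
    + by rewrite addr0.
    + by rewrite scaler0.
    + by apply: bop_ext.
  - by move=> d' M' _ _; rewrite !mxnormE opnorm_eq0_mxop lecR opnorm_ge0.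
  - by rewrite !mxnormE opnorm_eq0_mxop M0.
have Mpos : 0 < opnorm (mxop M) by rewrite lt_def M0 opnorm_ge0.
have [N frames] := invariant_frame d Balg Bfin.
have [L [u uo]] : exists (L : hilbertType R) (u : 'I_N -> L),
    forall i j, inner (u i) (u j) = (i == j)%:R :> R[i].
  (* Taking the whole norm as defect yields a vector with nonzero image, from which [L] is built. *)
  have [v _ vM] := opnorm_approx (mxop M) Mpos.
  apply: (@orthonormal_exists _ _ (mxop M v)).
  by rewrite -rnorm_eq0; apply: lt0r_neq0; move: vM; rewrite subrr.
have /choice[x_ xP] n : exists x : hpow K d, rnorm x <= 1 /\
    opnorm (mxop M) ^+ 2 - harmonic n <= rnorm (mxop M x) ^+ 2.
  by have [x] := @opnorm_approx_sqr _ _ (mxop M) (harmonic n) (harmonic_gt0 n); exists x.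
have /choice[F_ FP] n := frames (x_ n).
have Fo n : orthoframe (F_ n) by case: (FP n).
(* [U] refines convergence at infinity, so the defects [harmonic n] still tend to 0 along it. *)
have [U [UU Uoo]] := ultraFilterLemma (eventually_filter).
(* The entries of the compressions of [T] are bounded by its norm, uniformly in the frame, so the
   limit [pi T] exists for every operator. *)
have /choice[pi piP] T : exists m : 'M[R[i]]_N,
    forall i j, clim U (fun n => compression (F_ n) T i j) (m i j).
  have /choice[g gP] (ij : 'I_N * 'I_N) : exists z,
      clim U (fun n => compression (F_ n) T ij.1 ij.2) z.
    by apply: (bounded_clim (B := opnorm T)) => n; exact: compression_normc.
  by exists (\matrix_(i, j) g (i, j)) => i j; rewrite mxE; exact: (gP (i, j)).
(* The limits of the coordinates of [x_ n] in the varying frames form the vector at which the norm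
   is attained. *)
have [a aP] : exists a : 'I_d -> 'I_N -> R[i],
    forall q j, clim U (fun n => inner (x_ n q) (F_ n j)) (a q j).
  have /choice[g gP] (qj : 'I_d * 'I_N) : exists z,
      clim U (fun n => inner (x_ n qj.1) (F_ n qj.2)) z.
    apply: (bounded_clim (B := 1)) => n; rewrite (le_trans (normc_inner _ _))//.
    rewrite -[leRHS]mulr1 ler_pM ?rnorm_ge0//.
      by rewrite (le_trans (rnorm_coord _ _))//; case: (xP n).
    by rewrite -(@ler_pXn2r _ 2) ?nnegrE ?rnorm_ge0// expr1n; exact: frame_rnorm_le1.
  by exists (fun q j => g (q, j)) => q j; exact: (gP (q, j)).
have piE T (m : 'M[R[i]]_N) :
    (forall i j, clim U (fun n => compression (F_ n) T i j) (m i j)) -> pi T = m.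
  by move=> Tm; apply/matrixP => i j; exact: clim_unique (piP T i j) (Tm i j).
have pi_lin b S T : pi (b *: S + T) = b *: pi S + pi T.
  apply: piE => i j; rewrite (_ : (fun n => _) = (fun n =>
      b * compression (F_ n) S i j + compression (F_ n) T i j)); last first.
    by apply/funext => n; rewrite compression_linear 2!mxE.
  by rewrite 2!mxE; apply: climD; [apply: climM; [exact: clim_cst|]|]; exact: piP.
have pi_mul S T : B T -> pi (bop_comp S T) = pi S *m pi T.
  move=> BT; apply: piE => i j; rewrite mxE.
  rewrite (_ : (fun n => _) = (fun n =>
      \sum_k compression (F_ n) S i k * compression (F_ n) T k j)); last first.
    apply/funext => n; rewrite compressionM ?mxE// => k.
    by case: (FP n) => _ _ /(_ T BT)[].
  by apply: clim_sum => k; apply: climM; exact: piP.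
pose rho T := mxact u (pi T).
have rho_mx d' (M' : 'M[bop K]_d') : map_mx rho M' = \matrix_(p, q) mxact u (pi (M' p q)).
  by apply/matrixP => p q; rewrite !mxE.
have cc : completely_contractive B rho.
  move=> d' M' _ BM'; rewrite !mxnormE lecR rho_mx.
  apply: opnorm_mxop_mxact_le => // [|y]; first exact: opnorm_ge0.
  have lim1 := blocksqr_cvg (UU := UU) (fun p q => piP (M' p q))
    (fun q j => clim_cst (UU := UU) (y q j)).
  apply: (ler_cvg_to lim1 (cvg_cst _)); apply: filterE => n.
  exact: blocksqr_compression_le.
exists L, (matrix_units_algebra u), rho; split=> //.
- exact: matrix_units_cstar.
- exact: matrix_units_findim.
- split=> [T _|S T _ _|b T _|S T _ BT].
  + by exists (pi T).
  + by rewrite -[S]scale1r /rho pi_lin !scale1r mxactD.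
  + have pi0 : pi 0 = 0.
      by apply: (addrI (pi 0)); rewrite -[X in X + _]scale1r -pi_lin scaler0 !addr0.
    by rewrite -[b *: T]addr0 /rho pi_lin pi0 addr0 mxactZ.
  + by rewrite /rho pi_mul// mxactM.
rewrite !mxnormE; congr (_%:C)%C; apply/le_anti/andP; split.
  by have := cc d M d0 BM; rewrite !mxnormE lecR.
have lim := blocksqr_cvg (UU := UU) (fun p q => piP (M p q)) aP.
(* Both [x_ n] and its image under [M] have their coordinates in the span of [F_ n], so compressing
   loses nothing before the limit. *)
have normM : opnorm (mxop M) ^+ 2 <= blocksqr (fun p q => pi (M p q)) a.
  have hU : harmonic n @[n --> U] --> (0 : R) by move=> V /cvg_harmonic; exact: Uoo.
  rewrite -[leLHS]subr0; apply: (ler_cvg_to (cvgB (cvg_cst _) hU) lim).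
  apply: filterE => n; rewrite (le_trans (xP n).2)//= blocksqr_compressionE// rnorm_hpow.
  have [_ Fx FT] := FP n.
  have -> : hvec (fun q => fproj (F_ n) (x_ n q)) = x_ n by apply: hsum_ext => q /=.
  rewrite le_eqVlt; apply/orP; left; apply/eqP; apply: eq_bigr => p _.
  congr (rnorm _ ^+ 2); rewrite mxopE; elim/big_ind: _ => // [|v w Fv Fw|q _].
  - by rewrite /fproj big1// => i _; rewrite inner0l scale0r.
  - by rewrite -[v]scale1r fproj_linear -Fv -Fw.
  - by case: (FT _ (BM p q)).
have norma : \sum_q \sum_j Normc.normc (a q j) ^+ 2 <= 1.
  have lima : (\sum_q \sum_j Normc.normc (inner (x_ n q) (F_ n j)) ^+ 2)
      @[n --> U] --> \sum_q \sum_j Normc.normc (a q j) ^+ 2.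
    by apply: cvg_sumR => q; apply: cvg_sumR => j; exact: clim_normc_sqr.
  apply: (ler_cvg_to lima (cvg_cst _)); apply: filterE => n.
  apply: (@le_trans _ _ (rnorm (x_ n) ^+ 2)).
    by rewrite rnorm_hpow; apply: ler_sum => q _; exact: bessel.
  by rewrite expr_le1 ?rnorm_ge0//; case: (xP n).
(* The chain is $\|M\|^2 \le \|\pi(M)a\|^2 \le \|\rho(M)\|^2\|a\|^2 \le \|\rho(M)\|^2$. *)
rewrite -(@ler_pXn2r _ 2) ?nnegrE ?opnorm_ge0// (le_trans normM)//.
rewrite rho_mx (le_trans (blocksqr_le_opnorm uo _ _))//.
by rewrite -[leRHS]mulr1 ler_wpM2l ?sqr_ge0.
Qed.

Lemma completely_contractive_opnorm (R : realType) (H K : hilbertType R)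
    (A : set (bop H)) (f : bop H -> bop K) T :
  completely_contractive A f -> A T -> opnorm (f T) <= opnorm T.
Proof.
move=> fc AT; have AcT : mx_over A (const_mx T : 'M_1) by move=> p q; rewrite mxE.
by have := fc 1%N _ isT AcT; rewrite map_const_mx !mxnormE lecR !opnorm_mx11.
Qed.

(** * Diagonal operators on Hilbert sums *)

Section HilbertSumOperators.
Context (R : realType) (I : choiceType) (K : I -> hilbertType R).

Definition hinj_fun i (v : K i) : forall j, K j := dfwith (fun j => 0 : K j) v.

Lemma hinj_fun_sum i (v : K i) :
  rsummable (fun j => rnorm (hinj_fun v j) ^+ 2) /\
  rsum (fun j => rnorm (hinj_fun v j) ^+ 2) <= rnorm v ^+ 2.
Proof.
apply: rsum_le_bound => [j|X]; first exact: sqr_ge0.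
have out j : j != i -> rnorm (hinj_fun v j) ^+ 2 = 0.
  by move=> ji; rewrite /hinj_fun dfwith_out ?rnorm0 ?expr0n// eq_sym.
have [iX|iX] := boolP (i \in X).
  rewrite (bigD1_seq i) ?fset_uniq//= /hinj_fun dfwith_in big1 ?addr0// => j; exact: out.
rewrite big_seq big1 ?sqr_ge0// => j jX; apply: out.
by apply: contraNneq iX => <-.
Qed.

Definition hinj i (v : K i) : hsum K := HSum (hinj_fun_sum v).1.

Lemma hinjE i (v : K i) : hinj v i = v.
Proof. exact: dfwith_in. Qed.

Lemma rnorm_hinj i (v : K i) : rnorm (hinj v) ^+ 2 <= rnorm v ^+ 2.
Proof. by rewrite rnorm_hsum; exact: (hinj_fun_sum v).2. Qed.

Lemma hsum_sumE (J : Type) (r : seq J) (P : pred J) (F : J -> hsum K) i :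
  (\sum_(j <- r | P j) F j) i = \sum_(j <- r | P j) F j i.
Proof. by elim/big_rec2: _ => // j y x _ <-. Qed.

(** Exchanging the two sums regroups $(\bigoplus_i K_i)^{(d)}$ as $\bigoplus_i K_i^{(d)}$. *)
Lemma rsum_sum (J : finType) (f : J -> I -> R) : (forall j, rsummable (f j)) ->
  rsummable (fun i => \sum_j f j i) /\ rsum (fun i => \sum_j f j i) = \sum_j rsum (f j).
Proof.
move=> fs; elim: (index_enum J) => [|j r [IHs IHe]].
  have -> : (fun i => \sum_(j <- [::]) f j i) = fun=> 0.
    by apply/funext => i; rewrite big_nil.
  have [|X|s0 le0] := @rsum_le_bound R I (fun=> 0) 0 => //; first by rewrite big1.
  by split; rewrite // big_nil; apply/le_anti; rewrite le0 rsum_ge0.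
have -> : (fun i => \sum_(j <- j :: r) f j i) = f j \+ (fun i => \sum_(j <- r) f j i).
  by apply/funext => i; rewrite big_cons.
by split; [exact: rsummableD|rewrite rsumD// IHe big_cons].
Qed.

Lemma diagonal_operator (b : forall i, bop (K i)) (C : R) :
  (forall i, opnorm (b i) <= C) ->
  exists S : bop (hsum K), forall x i, S x i = b i (x i).
Proof.
move=> bC.
have bnd (x : hsum K) i : rnorm (b i (x i)) ^+ 2 <= C ^+ 2 * rnorm (x i) ^+ 2.
  rewrite (le_trans (le_opnorm_sqr _ _))// ler_wpM2r ?sqr_ge0//.
  by rewrite ler_pXn2r ?nnegrE ?opnorm_ge0// (le_trans (opnorm_ge0 (b i))).
have bs (x : hsum K) : rsummable (fun i => rnorm (b i (x i)) ^+ 2) /\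
    rsum (fun i => rnorm (b i (x i)) ^+ 2) <= C ^+ 2 * rnorm x ^+ 2.
  apply: rsum_le_bound => [i|X]; first exact: sqr_ge0.
  rewrite (le_trans (ler_sum _ (fun i _ => bnd x i)))// -mulr_sumr ler_wpM2l ?sqr_ge0//.
  by rewrite rnorm_hsum; apply: fin_rsum_le (hsumP x) => i; exact: sqr_ge0.
have SP : (fun x => HSum (bs x).1) \in @bounded_op R (hsum K).
  apply/asboolP; split=> [a x y|].
    by apply: hsum_ext => i /=; rewrite linearP.
  (* Over an empty index type [C] may be negative. *)
  exists `|C| => x; rewrite -(@ler_pXn2r _ 2) ?nnegrE ?mulr_ge0 ?rnorm_ge0//.
  by rewrite exprMn real_normK ?num_real// [X in X <= _]rnorm_hsum; exact: (bs x).2.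
by exists (Bop SP).
Qed.

Context (d : nat) (T : 'M[bop (hsum K)]_d) (b : forall i, 'M[bop (K i)]_d).
Hypothesis Tb : forall p q x i, T p q x i = b i p q (x i).

(** Apply [T] to vectors supported in summand [i] and read off that coordinate. *)
Lemma opnorm_mxop_coord i : opnorm (mxop (b i)) <= opnorm (mxop T).
Proof.
apply: opnorm_le_sqr => [|y]; first exact: opnorm_ge0.
pose z := hvec (fun q => hinj (y q)).
apply: (@le_trans _ _ (rnorm (mxop T z) ^+ 2)).
  rewrite !rnorm_hpow; apply: ler_sum => p _.
  rewrite ler_pXn2r ?nnegrE ?rnorm_ge0// (le_trans _ (rnorm_coord _ i))//.
  rewrite !mxopE hsum_sumE le_eqVlt; apply/orP; left; apply/eqP; congr rnorm.
  by apply: eq_bigr => q _; rewrite Tb hinjE.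
rewrite (le_trans (le_opnorm_sqr _ _))// ler_wpM2l ?sqr_ge0// !rnorm_hpow.
by apply: ler_sum => q _; exact: rnorm_hinj.
Qed.

(** After regrouping, [T] is block diagonal with blocks [b i], so the bound holds summand by
    summand. *)
Lemma opnorm_mxop_hsum (C : R) : 0 <= C ->
  (forall i, opnorm (mxop (b i)) <= C) -> opnorm (mxop T) <= C.
Proof.
move=> C0 bC; apply: opnorm_le_sqr => // z; rewrite !rnorm_hpow.
under eq_bigr do rewrite rnorm_hsum.
under [X in _ <= _ * X]eq_bigr do rewrite rnorm_hsum.
rewrite -(rsum_sum (fun p => hsumP (mxop T z p))).2.
have [zs <-] := rsum_sum (fun q => hsumP (z q)).
apply: (rsum_le_bound _ _).2 => [i|X]; first by apply: sumr_ge0 => p _; exact: sqr_ge0.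
apply: (@le_trans _ _ (\sum_(i <- X) C ^+ 2 * \sum_q rnorm (z q i) ^+ 2)).
  apply: ler_sum => i _; pose y := hvec (fun q => z q i).
  have := le_opnorm_sqr (mxop (b i)) y; rewrite !rnorm_hpow => le.
  under eq_bigr => p _ do (rewrite mxopE hsum_sumE; under eq_bigr do rewrite Tb).
  rewrite (le_trans le)// ler_wpM2r ?sumr_ge0// => [q _|]; first exact: sqr_ge0.
  by rewrite ler_pXn2r ?nnegrE ?opnorm_ge0.
rewrite -mulr_sumr ler_wpM2l ?sqr_ge0//; apply: fin_rsum_le zs => i.
by apply: sumr_ge0 => q _; exact: sqr_ge0.
Qed.

End HilbertSumOperators.

(** * Replacing the factors of a product by C*-algebras *)

(** Each factor is replaced by a family of homomorphisms, one for each matrix over it, so every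
    matrix has a coordinate preserving its norm. *)
Lemma cstar_residual (R : realType) (H : hilbertType R) (A : set (bop H))
    (Omega : choiceType) (K : Omega -> hilbertType R)
    (B : forall i, set (bop (K i))) (Phi : bop H -> bop (hsum K)) :
  operator_algebra A ->
  (forall i, operator_algebra (B i) /\ finite_dimensional (B i)) ->
  algebra_hom A (prod_algebra B) Phi -> completely_isometric A Phi ->
  exists (Omega' : choiceType) (L : Omega' -> hilbertType R)
      (C : forall i, set (bop (L i))) (Psi : bop H -> bop (hsum L)),
      [/\ forall i, cstar_algebra (C i) /\ finite_dimensional (C i),
          algebra_hom A (prod_algebra C) Psi &
          completely_isometric A Psi].
Proof.
move=> Aalg Balg Phom Piso.
have /choice[b bP] T : exists b : forall i, bop (K i), A T ->
    [/\ forall i, B i (b i), exists M : R, forall i, opnorm (b i) <= M &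
        forall (x : hsum K) i, Phi T x i = b i (x i)].
  have [AT|nAT] := pselect (A T); last by exists (fun=> 0).
  by have [b] := hom_sub Phom AT; exists b.
have bB T i : A T -> B i (b T i) by move=> /bP[].
(* The chosen coordinates are recovered from [Phi T] through [hinj], so they inherit the algebraic
   rules of [Phi]. *)
have bE T i v : A T -> b T i v = Phi T (hinj v) i.
  by move=> AT; have [_ _ ->] := bP T AT; rewrite hinjE.
have bD S T i : A S -> A T -> b (S + T) i = b S i + b T i.
  move=> AS AT; apply: bop_ext => v; rewrite bopDE !bE//; last exact: opalgD.
  by rewrite (homD Phom).
have bZ a T i : A T -> b (a *: T) i = a *: b T i.
  move=> AT; apply: bop_ext => v; rewrite bopZE !bE//; last exact: opalgZ.
  by rewrite (homZ Phom).
have bM S T i : A S -> A T -> b (bop_comp S T) i = bop_comp (b S i) (b T i).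
  move=> AS AT; apply: bop_ext => v; rewrite [RHS]/= bE; last exact: opalgM.
  have [_ _ bS] := bP S AS; have [_ _ bT] := bP T AT.
  by rewrite (homM Phom)//= bS bT hinjE.
(* All matrices over [bop (K i)] serve as indices, including those with entries outside [B i]; the
   size [d.+1] excludes empty matrices. *)
pose J := {i : Omega & {d : nat & 'M[bop (K i)]_d.+1}}.
pose Y i (L : hilbertType R) := (set (bop L) * (bop (K i) -> bop L))%type.
have ex (j : J) : exists x : {L : hilbertType R & Y (tag j) L},
    let C := (tagged x).1 in let rho := (tagged x).2 in
    [/\ cstar_algebra C, finite_dimensional C, algebra_hom (B (tag j)) C rho,
        completely_contractive (B (tag j)) rho &
        mx_over (B (tag j)) (tagged (tagged j)) ->
        mxnorm (map_mx rho (tagged (tagged j))) = mxnorm (tagged (tagged j))].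
  case: j => i [d M] /=; have [Bi Bf] := Balg i.
  have [BM|nBM] := pselect (mx_over (B i) M).
    have [L [C [rho [? ? ? ? ?]]]] := findim_cstar_attained (isT : 0 < d.+1)%N Bi Bf BM.
    by exists (existT (Y i) L (C, rho)).
  (* An index matrix not over [B i] only needs some admissible homomorphism, here the one obtained
     for the zero matrix. *)
  have B0 : mx_over (B i) (const_mx 0 : 'M[bop (K i)]_1).
    by move=> p q; rewrite mxE; exact: opalg0.
  have [L [C [rho [? ? ? ? _]]]] := findim_cstar_attained (isT : 0 < 1)%N Bi Bf B0.
  by exists (existT (Y i) L (C, rho)).
pose x j := projT1 (cid (ex j)); have xP j := projT2 (cid (ex j)).
pose L j := tag (x j); pose C j : set (bop (L j)) := (tagged (x j)).1.
pose rho j : bop (K (tag j)) -> bop (L j) := (tagged (x j)).2.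
have /choice[Psi PsiP] T : exists S : bop (hsum L), A T ->
    forall y j, S y j = rho j (b T (tag j)) (y j).
  have [AT|nAT] := pselect (A T); last by exists 0.
  have [_ [M bM'] _] := bP T AT.
  have [|S SP] := @diagonal_operator R J L (fun j => rho j (b T (tag j))) M.
    move=> j; rewrite (le_trans _ (bM' (tag j)))//; have [_ _ _ rc _] := xP j.
    by apply: (completely_contractive_opnorm rc); exact: bB.
  by exists S.
exists J, L, C, Psi; split.
- by move=> j; have [] := xP j.
- split=> [T AT|S T AS AT|a T AT|S T AS AT].
  + exists (fun j => rho j (b T (tag j))); split=> [j||y j].
    * by have [_ _ rh _ _] := xP j; apply: (hom_sub rh); exact: bB.
    * have [_ [M bM'] _] := bP T AT; exists M => j.
      rewrite (le_trans _ (bM' (tag j)))//; have [_ _ _ rc _] := xP j.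
      by apply: (completely_contractive_opnorm rc); exact: bB.
    * exact: PsiP.
  + apply: bop_ext => y; apply: hsum_ext => j; have [_ _ rh _ _] := xP j.
    rewrite PsiP ?bopDE ?hsumDE ?PsiP//; last exact: opalgD.
    by rewrite bD// /rho (homD rh)//; exact: bB.
  + apply: bop_ext => y; apply: hsum_ext => j; have [_ _ rh _ _] := xP j.
    rewrite PsiP ?bopZE ?hsumZE ?PsiP//; last exact: opalgZ.
    by rewrite bZ// /rho (homZ rh)//; exact: bB.
  + apply: bop_ext => y; apply: hsum_ext => j; have [_ _ rh _ _] := xP j.
    rewrite PsiP /= ?PsiP//; last exact: opalgM.
    by rewrite bM// /rho (homM rh)//; exact: bB.
move=> d M d0 AM; rewrite -(Piso d M d0 AM) !mxnormE; congr (_%:C)%C.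
pose m i : 'M[bop (K i)]_d := \matrix_(p, q) b (M p q) i.
have mB i : mx_over (B i) (m i) by move=> p q; rewrite mxE; exact: bB.
have Pm p q z i : map_mx Phi M p q z i = m i p q (z i).
  by rewrite !mxE; have [_ _ ->] := bP _ (AM p q).
have Pr p q z j : map_mx Psi M p q z j = map_mx (rho j) (m (tag j)) p q (z j).
  by rewrite !mxE PsiP.
apply/le_anti/andP; split.
  (* Each coordinate of [Psi] is a complete contraction applied to a coordinate of [Phi]. *)
  apply: (opnorm_mxop_hsum Pr) => [|j]; first exact: opnorm_ge0.
  rewrite (le_trans _ (opnorm_mxop_coord Pm (tag j)))//.
  by have [_ _ _ rc _] := xP j; have := rc d _ d0 (mB (tag j)); rewrite !mxnormE lecR.
apply: (opnorm_mxop_hsum Pm) => [|i]; first exact: opnorm_ge0.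
case: d d0 M AM m mB Pm Pr => // d _ M AM m mB Pm Pr.
(* The coordinate indexed by the matrix [m i] itself attains the norm of [m i]. *)
pose j : J := Tagged _ (Tagged _ (m i)).
have [_ _ _ _ /(_ (mB i))] := xP j; rewrite !mxnormE => /complexI <-.
exact: (opnorm_mxop_coord Pr j).
Qed.

Theorem theorem1p1 (R : realType) (H : hilbertType R) (A : set (bop H))
    (hA : operator_algebra A) :
  ((exists (Omega : choiceType) (K : Omega -> hilbertType R)
      (B : forall i, set (bop (K i))) (Phi : bop H -> bop (hsum K)),
      [/\ forall i, operator_algebra (B i) /\ finite_dimensional (B i),
          algebra_hom A (prod_algebra B) Phi &
          completely_isometric A Phi])
   <->
   (exists (Omega : choiceType) (K : Omega -> hilbertType R)
      (B : forall i, set (bop (K i))) (Phi : bop H -> bop (hsum K)),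
      [/\ forall i, cstar_algebra (B i) /\ finite_dimensional (B i),
          algebra_hom A (prod_algebra B) Phi &
          completely_isometric A Phi]))
  /\
  ((forall (d : nat) (M : 'M[bop H]_d), (0 < d)%N -> mx_over A M ->
      exists (K : hilbertType R) (B : set (bop K)) (pi : bop H -> bop K),
      [/\ operator_algebra B, finite_dimensional B,
          algebra_hom A B pi, completely_contractive A pi &
          mxnorm (map_mx pi M) = mxnorm M])
   <->
   (forall (d : nat) (M : 'M[bop H]_d), (0 < d)%N -> mx_over A M ->
      exists (K : hilbertType R) (B : set (bop K)) (pi : bop H -> bop K),
      [/\ cstar_algebra B, finite_dimensional B,
          algebra_hom A B pi, completely_contractive A pi &
          mxnorm (map_mx pi M) = mxnorm M])).
Proof.
split; split.
- by move=> [Omega [K [B [Phi [Balg Phom Piso]]]]]; exact: cstar_residual Phom Piso.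
- move=> [Omega [K [B [Phi [Balg Phom Piso]]]]]; exists Omega, K, B, Phi; split=> // i.
  by have [/cstar_opalg ? ?] := Balg i.
- move=> att d M d0 AM; have [K [B [pi [Balg Bfin pih pic piM]]]] := att d M d0 AM.
  have BpiM : mx_over B (map_mx pi M) by move=> p q; rewrite mxE; exact: (hom_sub pih).
  (* The homomorphism [rho] is chosen for the image of [M] under [pi], so the composite still
     attains the norm of [M]. *)
  have [L [C [rho [Calg Cfin rhoh rhoc rhoM]]]] :=
    findim_cstar_attained d0 Balg Bfin BpiM.
  have mapE d' (M' : 'M[bop H]_d') : map_mx (rho \o pi) M' = map_mx rho (map_mx pi M').
    by rewrite map_mx_comp.
  exists L, C, (rho \o pi); split=> //.
  + split=> [T AT|S T AS AT|a T AT|S T AS AT] /=.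
    * by apply: (hom_sub rhoh); exact: (hom_sub pih).
    * by rewrite (homD pih)// (homD rhoh)//; exact: (hom_sub pih).
    * by rewrite (homZ pih)// (homZ rhoh)//; exact: (hom_sub pih).
    * by rewrite (homM pih)// (homM rhoh)//; exact: (hom_sub pih).
  + move=> d' M' d'0 AM'; rewrite mapE (le_trans _ (pic d' M' d'0 AM'))//.
    by apply: rhoc => // p q; rewrite mxE; exact: (hom_sub pih).
  + by rewrite mapE rhoM.
- move=> att d M d0 AM; have [K [B [pi [Balg Bfin pih pic piM]]]] := att d M d0 AM.
  by exists K, B, pi; split=> //; exact: cstar_opalg.
Qed.
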